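(* For every $n\ge 1$, the $SL_2$-character of $OS_2^+(n)$, for the $SL_2$-action arising from the natural action on the set of generators, is equal to $$\prod_{k=1}^{n-1}\bigl(1+kq+(n-k)q^{-1}\bigr).$$
   Context: Over $\mathbb{Q}$, the double even Orlik--Solomon algebra $OS_2^+(n)$ is the unital commutative associative algebra with generators $x_{ij},y_{ij}$, $1\le i\ne j\le n$, and relations (for all $i\ne j$, respectively all pairwise distinct $i,j,k$): $x_{ij}+x_{ji}=y_{ij}+y_{ji}=0$; $x_{ij}x_{jk}+x_{jk}x_{ki}+x_{ki}x_{ij}=0$; $x_{ij}y_{jk}+x_{jk}y_{ki}+x_{ki}y_{ij}+y_{ij}x_{jk}+y_{jk}x_{ki}+y_{ki}x_{ij}=0$; $y_{ij}y_{jk}+y_{jk}y_{ki}+y_{ki}y_{ij}=0$; $x_{ij}^2=x_{ij}y_{ij}=y_{ij}^2=0$. The group $SL_2$ acts on $OS_2^+(n)$ by algebra automorphisms so that for every pair $i\neq j$ the span of $x_{ij},y_{ij}$ is the standard two-dimensional representation with basis $x_{ij},y_{ij}$ (the same matrices for all pairs). The $SL_2$-character is the trace of $\mathrm{diag}(q,q^{-1})$ as a Laurent polynomial in $q$. *)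

(* Defs.v *)
From HB Require Import structures.
From mathcomp Require Import all_boot all_order all_algebra.
From mathcomp Require Import generic_quotient ring_quotient fraction.
From mathcomp Require Import mpoly ring.
From mathcomp Require boolp.

Set Implicit Arguments.
Unset Strict Implicit.
Unset Printing Implicit Defensive.

Import GRing.Theory.
Local Open Scope ring_scope.
Local Open Scope quotient_scope.

Record sl2 := Sl2 { sl2_mx :> 'M[rat]_2; _ : \det sl2_mx == 1 }.

HB.instance Definition _ := [isSub for sl2_mx].
HB.instance Definition _ := [Choice of sl2 by <:].

Section SL2Group.

Lemma det_sl2 (g : sl2) : \det g = 1.
Proof. by case: g => g /= /eqP. Qed.

Lemma unitmx_sl2 (g : sl2) : (g : 'M_2) \in unitmx.
Proof. by rewrite unitmxE det_sl2 unitr1. Qed.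

Fact sl2_one_subproof : \det (1%:M : 'M[rat]_2) == 1.
Proof. by rewrite det1. Qed.
Definition sl2_one := Sl2 sl2_one_subproof.

Fact sl2_mul_subproof (g h : sl2) : \det (g *m h) == 1.
Proof. by rewrite det_mulmx !det_sl2 mulr1. Qed.
Definition sl2_mul (g h : sl2) := Sl2 (sl2_mul_subproof g h).

Fact sl2_inv_subproof (g : sl2) : \det (invmx g) == 1.
Proof. by rewrite det_inv det_sl2 invr1. Qed.
Definition sl2_inv (g : sl2) := Sl2 (sl2_inv_subproof g).

Fact sl2_mulA : associative sl2_mul.
Proof. by move=> g h k; apply: val_inj; rewrite /= mulmxA. Qed.
Fact sl2_mul1 : left_id sl2_one sl2_mul.
Proof. by move=> g; apply: val_inj; rewrite /= mul1mx. Qed.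
Fact sl2_mulr1 : right_id sl2_one sl2_mul.
Proof. by move=> g; apply: val_inj; rewrite /= mulmx1. Qed.
Fact sl2_mulV : left_inverse sl2_one sl2_inv sl2_mul.
Proof. by move=> g; apply: val_inj; rewrite /= mulVmx ?unitmx_sl2. Qed.
Fact sl2_mulrV : right_inverse sl2_one sl2_inv sl2_mul.
Proof. by move=> g; apply: val_inj; rewrite /= mulmxV ?unitmx_sl2. Qed.

HB.instance Definition _ :=
  isGroup.Build sl2 sl2_mulA sl2_mul1 sl2_mulr1 sl2_mulV sl2_mulrV.

Definition torus_mx (q : rat) : 'M[rat]_2 :=
  diag_mx (\row_(c < 2) if c == 0 then q else q^-1).

Fact torus_subproof (q : rat) (q0 : q != 0) : \det (torus_mx q) == 1.
Proof. by rewrite det_diag big_ord_recl big_ord1 !mxE /= divff. Qed.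

Definition torus (q : rat) (q0 : q != 0) : sl2 := Sl2 (torus_subproof q0).

End SL2Group.

Definition laurent_q : {fraction {poly rat}} := tofrac 'X.

Section Character.

Variable V : lmodType rat.

Definition is_basis d (b : 'I_d -> V) : Prop :=
  forall v : V, exists! c : 'rV[rat]_d, v = \sum_i c 0 i *: b i.

(* V carries no finite-dimensional structure, so the trace is a relation; it
   entails that V has a finite basis, and t does not depend on the basis. *)
Definition has_trace (f : V -> V) (t : rat) : Prop :=
  exists d (b : 'I_d -> V) (M : 'M[rat]_d),
    [/\ is_basis b, forall j, f (b j) = \sum_i M i j *: b i & \tr M = t].

(* Laurent polynomials over Q are the elements p / q^m of the field Q(q), with
   p in Q[q].  As Q is infinite, chi is determined by its values on Q^*. *)
Definition is_sl2_character (rho : sl2 -> V -> V)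
    (chi : {fraction {poly rat}}) : Prop :=
  exists (p : {poly rat}) (m : nat),
    chi = tofrac p / laurent_q ^+ m /\
    forall (q : rat) (q0 : q != 0),
      has_trace (rho (torus q0)) (p.[q] / q ^+ m).

End Character.

Definition generated_ideal (R : comNzRingType) (rel : R -> Prop) (p : R) :
    Prop :=
  exists s : seq (R * R),
    (forall ar, ar \in s -> rel ar.2) /\ p = \sum_(ar <- s) ar.1 * ar.2.

Section OrlikSolomon.

Variable n : nat.

(* The letter 0 : 'I_2 stands for x and 1 : 'I_2 for y. *)
Definition os_gen := ('I_2 * {e : 'I_n * 'I_n | e.1 != e.2})%type.

Definition os_poly := {mpoly rat[#|{: os_gen}|]}.

Definition os_var (t : os_gen) : os_poly := 'X_(enum_rank t).

(* The value 0 on the diagonal is a dummy, never used in the relations. *)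
Definition os_letter (c : 'I_2) (i j : 'I_n) : os_poly :=
  if insub (i, j) is Some e then os_var (c, e) else 0.

Local Notation x := (os_letter 0).
Local Notation y := (os_letter 1).

Inductive os_rel : os_poly -> Prop :=
| os_antisym_x i j of i != j : os_rel (x i j + x j i)
| os_antisym_y i j of i != j : os_rel (y i j + y j i)
| os_arnold_xx i j k of i != j & j != k & k != i :
    os_rel (x i j * x j k + x j k * x k i + x k i * x i j)
| os_arnold_xy i j k of i != j & j != k & k != i :
    os_rel (x i j * y j k + x j k * y k i + x k i * y i j
            + y i j * x j k + y j k * x k i + y k i * x i j)
| os_arnold_yy i j k of i != j & j != k & k != i :
    os_rel (y i j * y j k + y j k * y k i + y k i * y i j)
| os_square_xx i j of i != j : os_rel (x i j ^+ 2)
| os_square_xy i j of i != j : os_rel (x i j * y i j)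
| os_square_yy i j of i != j : os_rel (y i j ^+ 2).

Definition os_ideal (p : os_poly) : bool :=
  boolp.asbool (generated_ideal os_rel p).

Lemma os_idealP p : reflect (generated_ideal os_rel p) (p \in os_ideal).
Proof. exact: boolp.asboolP. Qed.

Lemma os_rel_ideal p : os_rel p -> p \in os_ideal.
Proof.
move=> rp; apply/os_idealP; exists [:: (1, p)]; split.
  by move=> ar; rewrite inE => /eqP->.
by rewrite big_seq1 mul1r.
Qed.

Lemma os_letter_meval0 c i j : (os_letter c i j).@[fun=> 0] = 0.
Proof.
rewrite /os_letter; case: insubP => [e _ _|_]; last by rewrite meval0.
by rewrite /os_var mevalXU.
Qed.

Lemma os_rel_meval0 p : os_rel p -> p.@[fun=> 0] = 0.
Proof.
by case=> *; rewrite ?(mevalD, mevalM, expr2, os_letter_meval0, mulr0, addr0).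
Qed.

Fact os_idealr_closed : idealr_closed os_ideal.
Proof.
split.
- by apply/os_idealP; exists [::]; split=> //; rewrite big_nil.
- apply/os_idealP => -[s [hs /(congr1 (meval (fun=> 0)))]].
  rewrite meval1 raddf_sum big_seq big1 => [/eqP|ar /hs/os_rel_meval0 h].
    by rewrite oner_eq0.
  by rewrite /= mevalM h mulr0.
- move=> a p q /os_idealP[s [hs ->]] /os_idealP[t [ht ->]].
  apply/os_idealP; exists ([seq (a * ar.1, ar.2) | ar <- s] ++ t); split.
    move=> ar; rewrite mem_cat => /orP[/mapP[b bs ->]|/ht//]; exact: hs bs.
  rewrite big_cat big_map mulr_sumr; congr (_ + _).
  by apply: eq_bigr => ar _; rewrite mulrA.
Qed.

HB.instance Definition _ := isIdealr.Build os_poly os_ideal os_idealr_closed.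

Definition os := {ideal_quot (Idealr.clone os_poly os_ideal _)}.

HB.instance Definition _ := GRing.ComNzRing.on os.

Definition os_pi (p : os_poly) : os := \pi_os p.

Fact os_pi_zmod_morphism : zmod_morphism os_pi.
Proof. exact: (rmorphB (\pi_os : {rmorphism os_poly -> os})). Qed.
Fact os_pi_monoid_morphism : monoid_morphism os_pi.
Proof.
split; first exact: (rmorph1 (\pi_os : {rmorphism os_poly -> os})).
exact: (rmorphM (\pi_os : {rmorphism os_poly -> os})).
Qed.
HB.instance Definition _ :=
  GRing.isZmodMorphism.Build os_poly os os_pi os_pi_zmod_morphism.
HB.instance Definition _ :=
  GRing.isMonoidMorphism.Build os_poly os os_pi os_pi_monoid_morphism.

Lemma os_pi_eq0 p : (os_pi p == 0) = (p \in os_ideal).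
Proof. by rewrite -(rmorph0 os_pi) -Quotient.idealrBE subr0. Qed.

Lemma os_reprK (u : os) : os_pi (repr u) = u.
Proof. exact: reprK. Qed.

Lemma os_piP (u : os) : exists p, u = os_pi p.
Proof. by exists (repr u); rewrite os_reprK. Qed.

Definition os_scale (a : rat) (u : os) : os := os_pi a%:MP * u.

Fact os_scaleA a b u : os_scale a (os_scale b u) = os_scale (a * b) u.
Proof. by rewrite /os_scale mulrA -rmorphM mpolyCM. Qed.
Fact os_scale1 : left_id 1 os_scale.
Proof. by move=> u; rewrite /os_scale rmorph1 mul1r. Qed.
Fact os_scaleDr : right_distributive os_scale +%R.
Proof. by move=> a u v; rewrite /os_scale mulrDr. Qed.
Fact os_scaleDl u : {morph os_scale^~ u : a b / a + b}.
Proof. by move=> a b; rewrite /os_scale mpolyCD rmorphD mulrDl. Qed.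
HB.instance Definition _ := GRing.Zmodule_isLmodule.Build rat os
  os_scaleA os_scale1 os_scaleDr os_scaleDl.

Fact os_scaleAl a (u v : os) : a *: (u * v) = (a *: u) * v.
Proof. by rewrite /GRing.scale /= /os_scale mulrA. Qed.
HB.instance Definition _ :=
  GRing.Lmodule_isLalgebra.Build rat os os_scaleAl.
HB.instance Definition _ := GRing.Lalgebra_isComAlgebra.Build rat os.

Fact os_pi_scalable : scalable os_pi.
Proof. by move=> a p; rewrite -mul_mpolyC rmorphM. Qed.
HB.instance Definition _ :=
  GRing.isScalable.Build rat os_poly os *:%R os_pi os_pi_scalable.

(* Columns are images: x |-> g 0 0 x + g 1 0 y and y |-> g 0 1 x + g 1 1 y,
   which makes g |-> os_subst g a left action. *)
Definition os_subst (g : 'M[rat]_2) (p : os_poly) : os_poly :=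
  p \mPo [tuple \sum_(c < 2) g c (enum_val k).1 *: os_var (c, (enum_val k).2)
         | k < #|{: os_gen}|].

HB.instance Definition _ g := GRing.LRMorphism.copy (os_subst g)
  (fun p => p \mPo [tuple \sum_(c < 2)
     g c (enum_val k).1 *: os_var (c, (enum_val k).2) | k < #|{: os_gen}|]).

Lemma os_subst_var g t :
  os_subst g (os_var t) = \sum_(c < 2) g c t.1 *: os_var (c, t.2).
Proof.
by rewrite /os_subst /os_var comp_mpolyXU -tnth_nth tnth_mktuple enum_rankK.
Qed.

Lemma os_subst_letter g c i j :
  os_subst g (os_letter c i j) = \sum_(d < 2) g d c *: os_letter d i j.
Proof.
rewrite /os_letter; case: insubP => [e _ _|_]; last first.
  by rewrite rmorph0 big1 // => d _; rewrite scaler0.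
exact: os_subst_var.
Qed.

Lemma os_subst_rel g p : os_rel p -> os_subst g p \in os_ideal.
Proof.
have E c i j : os_subst g (os_letter c i j) =
    (g 0 c)%:MP * x i j + (g 1 c)%:MP * y i j.
  rewrite os_subst_letter big_ord_recl big_ord1 -!mul_mpolyC.
  by congr (_ + (g _ _)%:MP * os_letter _ _ _); apply: val_inj.
have comb (a b c q r t z : os_poly) : os_rel q -> os_rel r -> os_rel t ->
    z = a * q + b * r + c * t -> z \in os_ideal.
  by move=> hq hr ht ->; rewrite !rpredD ?idealMr ?os_rel_ideal.
case=> {p} [i j ij|i j ij|i j k ij jk ki|i j k ij jk ki|i j k ij jk ki
  |i j ij|i j ij|i j ij]; rewrite ?rmorphD ?rmorphXn ?rmorphM /= !E.
- apply: (comb (g 0 0)%:MP (g 1 0)%:MP 0) (os_antisym_x ij)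
    (os_antisym_y ij) (os_antisym_y ij) _; ring.
- apply: (comb (g 0 1)%:MP (g 1 1)%:MP 0) (os_antisym_x ij)
    (os_antisym_y ij) (os_antisym_y ij) _; ring.
- apply: (comb ((g 0 0)%:MP ^+ 2) ((g 0 0)%:MP * (g 1 0)%:MP)
    ((g 1 0)%:MP ^+ 2)) (os_arnold_xx ij jk ki) (os_arnold_xy ij jk ki)
    (os_arnold_yy ij jk ki) _; ring.
- apply: (comb (2%:R * (g 0 0)%:MP * (g 0 1)%:MP)
    ((g 0 0)%:MP * (g 1 1)%:MP + (g 0 1)%:MP * (g 1 0)%:MP)
    (2%:R * (g 1 0)%:MP * (g 1 1)%:MP)) (os_arnold_xx ij jk ki)
    (os_arnold_xy ij jk ki) (os_arnold_yy ij jk ki) _; ring.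
- apply: (comb ((g 0 1)%:MP ^+ 2) ((g 0 1)%:MP * (g 1 1)%:MP)
    ((g 1 1)%:MP ^+ 2)) (os_arnold_xx ij jk ki) (os_arnold_xy ij jk ki)
    (os_arnold_yy ij jk ki) _; ring.
- apply: (comb ((g 0 0)%:MP ^+ 2) (2%:R * (g 0 0)%:MP * (g 1 0)%:MP)
    ((g 1 0)%:MP ^+ 2)) (os_square_xx ij) (os_square_xy ij)
    (os_square_yy ij) _; ring.
- apply: (comb ((g 0 0)%:MP * (g 0 1)%:MP)
    ((g 0 0)%:MP * (g 1 1)%:MP + (g 0 1)%:MP * (g 1 0)%:MP)
    ((g 1 0)%:MP * (g 1 1)%:MP)) (os_square_xx ij) (os_square_xy ij)
    (os_square_yy ij) _; ring.
- apply: (comb ((g 0 1)%:MP ^+ 2) (2%:R * (g 0 1)%:MP * (g 1 1)%:MP)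
    ((g 1 1)%:MP ^+ 2)) (os_square_xx ij) (os_square_xy ij)
    (os_square_yy ij) _; ring.
Qed.

Fact os_subst_ideal g p : p \in os_ideal -> os_subst g p \in os_ideal.
Proof.
move=> /os_idealP[s [hs ->]]; rewrite rmorph_sum big_seq rpred_sum //= => ar.
by move=> /hs/(os_subst_rel g) h; rewrite rmorphM idealMr.
Qed.

Lemma os_subst1 p : os_subst 1%:M p = p.
Proof.
rewrite -[RHS]comp_mpoly_id /os_subst; congr comp_mpoly.
apply: eq_from_tnth => k; rewrite !tnth_mktuple (bigD1 (enum_val k).1) //=.
rewrite mxE eqxx scale1r big1 ?addr0 => [|c /negPf nc].
  by rewrite /os_var -surjective_pairing enum_valK.
by rewrite mxE nc scale0r.
Qed.

Lemma os_substM g h p : os_subst (g *m h) p = os_subst g (os_subst h p).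
Proof.
have X k : os_subst (g *m h) 'X_k = os_subst g (os_subst h 'X_k).
  rewrite -[k]enum_valK -/(os_var _) !os_subst_var linear_sum /=.
  under [RHS]eq_bigr => d _ do rewrite linearZ /= os_subst_var scaler_sumr.
  rewrite exchange_big; apply: eq_bigr => c _ /=; rewrite mxE scaler_suml.
  by apply: eq_bigr => d _; rewrite scalerA mulrC.
elim/mpolyind: p => [|a m p _ _ IHp]; first by rewrite !rmorph0.
rewrite !linearD !linearZ /= IHp mpolyXE_id !rmorph_prod /=.
congr (_ *: _ + _); apply: eq_bigr => k _.
by rewrite !rmorphXn /= X.
Qed.

Definition os_act (g : sl2) (u : os) : os := os_pi (os_subst g (repr u)).

Lemma os_subst_pi g p q :
  os_pi p = os_pi q -> os_pi (os_subst g p) = os_pi (os_subst g q).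
Proof.
move/eqP; rewrite -subr_eq0 -rmorphB os_pi_eq0 => /(os_subst_ideal g) pq.
by apply/eqP; rewrite -subr_eq0 -rmorphB os_pi_eq0 -rmorphB.
Qed.

Lemma os_act_pi g p : os_act g (os_pi p) = os_pi (os_subst g p).
Proof. by apply: os_subst_pi; rewrite os_reprK. Qed.

Fact os_act_zmod_morphism g : zmod_morphism (os_act g).
Proof.
move=> u v; have [p ->] := os_piP u; have [q ->] := os_piP v.
by rewrite -rmorphB !os_act_pi !rmorphB.
Qed.
Fact os_act_monoid_morphism g : monoid_morphism (os_act g).
Proof.
split=> [|u v]; first by rewrite -(rmorph1 os_pi) os_act_pi !rmorph1.
have [p ->] := os_piP u; have [q ->] := os_piP v.
by rewrite -rmorphM !os_act_pi !rmorphM.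
Qed.
Fact os_act_scalable g : scalable (os_act g).
Proof.
by move=> a u; have [p ->] := os_piP u; rewrite -linearZ !os_act_pi !linearZ.
Qed.
HB.instance Definition _ g :=
  GRing.isZmodMorphism.Build os os (os_act g) (os_act_zmod_morphism g).
HB.instance Definition _ g :=
  GRing.isMonoidMorphism.Build os os (os_act g) (os_act_monoid_morphism g).
HB.instance Definition _ g :=
  GRing.isScalable.Build rat os os *:%R (os_act g) (os_act_scalable g).

Lemma os_act1 u : os_act 1%g u = u.
Proof. by have [p ->] := os_piP u; rewrite os_act_pi os_subst1. Qed.

Lemma os_actM g h u : os_act (g * h)%g u = os_act g (os_act h u).
Proof. by have [p ->] := os_piP u; rewrite !os_act_pi os_substM. Qed.

Lemma os_act_letter g c i j : os_act g (os_pi (os_letter c i j)) =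
  \sum_(d < 2) g d c *: os_pi (os_letter d i j).
Proof.
rewrite os_act_pi os_subst_letter linear_sum.
by apply: eq_bigr => d _; rewrite linearZ.
Qed.

End OrlikSolomon.

(* Main.v *)
Require Import Defs.
From HB Require Import structures.
From mathcomp Require Import all_boot all_order all_algebra.
From mathcomp Require Import fingroup perm fraction mpoly ring.

(** Orient an edge from i to j and give it the letter x if i < j and y if
    i > j.  The monomials of the rooted forests on {1,...,n}, with edges
    pointing away from the roots, form a basis of OS_2^+(n).

    Spanning: the product of two rooted trees by a letter joining them is a
    combination of rooted trees.  One inducts on the largest label v.  Two
    arrows into v merge by the xx relation; an arrow from v to a vertex i of a
    tree T moves to the parent of i by the relation on i, its parent and v, all
    other terms having smaller pieces attached to v.  A letter within a
    connected component gives 0.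

    Independence: a binary bracketing of the labels, with coloured nodes, sends
    a letter to plus or minus the variable of the lowest common node of its two
    ends if the colours agree and to 0 otherwise; the relations then have no
    multilinear coefficient.  Splitting at the top node shows that a linear
    dependence f among rooted forests satisfies, for all forests F', F'' on
    complementary sets and each colour, an identity expressing that the signed
    sum of f over the ways of connecting F' to F'' by one arrow of this colour
    is 0.  With v the largest label, this forces f to vanish on the forests
    where v is a root, by induction on the number of children of v, and then on
    all others, by descending induction on the size of the subtree at v.

    The torus acts on the monomial of a forest by q to the number of ascents
    minus the number of descents, and the matrix-tree theorem evaluates the
    sum of these weights as a determinant, which is made triangular by
    subtracting consecutive rows. *)

Set Implicit Arguments.
Unset Strict Implicit.
Unset Printing Implicit Defensive.

Import GRing.Theory.
Local Open Scope ring_scope.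

(** * Joining rooted trees *)

Section Span.

Variable R : comAlgType rat.
Implicit Types (P Q : R -> Prop) (u v : R).

Inductive linspan P : R -> Prop :=
| linspan0 : linspan P 0
| linspan_gen u : P u -> linspan P u
| linspanD u v : linspan P u -> linspan P v -> linspan P (u + v)
| linspanZ a u : linspan P u -> linspan P (a *: u).

Lemma linspanN P u : linspan P u -> linspan P (- u).
Proof. by rewrite -scaleN1r; apply: linspanZ. Qed.

Lemma linspanB P u v : linspan P u -> linspan P v -> linspan P (u - v).
Proof. by move=> Pu /linspanN; apply: linspanD. Qed.

Lemma linspan_mul P Q a u :
  (forall u, P u -> linspan Q (a * u)) -> linspan P u -> linspan Q (a * u).
Proof.
move=> PQ; elim=> [|w /PQ//|w w' _ ? _ ?|b w _ ?].
  by rewrite mulr0; apply: linspan0.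
  by rewrite mulrDr; apply: linspanD.
by rewrite -scalerAr; apply: linspanZ.
Qed.

End Span.

(** * Disjoint sets of labels and bounds on labels *)

Section DisjointSets.

Variable n : nat.
Implicit Types (A B C : {set 'I_n}) (m : nat) (i : 'I_n).

Definition disj A B := A :&: B == set0.
Definition below m A := A \subset [set i : 'I_n | (i < m)%N].

Lemma disjC A B : disj A B = disj B A.
Proof. by rewrite /disj setIC. Qed.

Lemma disjUl A B C : disj (A :|: B) C = disj A C && disj B C.
Proof. by rewrite /disj setIUl setU_eq0. Qed.

Lemma disjUr A B C : disj A (B :|: C) = disj A B && disj A C.
Proof. by rewrite disjC disjUl !(disjC A). Qed.

Lemma disj_neq A B i j : disj A B -> i \in A -> j \in B -> i != j.
Proof.
move=> /eqP dAB iA jB; apply: contraPneq dAB => ij; apply/eqP/set0Pn.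
by exists j; rewrite inE -{1}ij iA.
Qed.

Lemma disj_notin A B i : disj A B -> i \in B -> i \notin A.
Proof. by move=> dAB iB; apply/negP => /(disj_neq dAB)/(_ iB); rewrite eqxx. Qed.

Lemma belowU m A B : below m (A :|: B) = below m A && below m B.
Proof. exact: subUset. Qed.

Lemma below_lt m A i : below m A -> i \in A -> (i < m)%N.
Proof. by move=> /subsetP bA /bA; rewrite inE. Qed.

Lemma belowS (v : 'I_n) A : below v.+1 A -> v \notin A -> below v A.
Proof.
move=> bA vA; apply/subsetP => i iA; rewrite inE ltn_neqAle -ltnS.
by rewrite (below_lt bA iA) andbT; apply: contraNneq vA => /val_inj <-.
Qed.

Lemma disj_card_lt A B i k : disj A B -> i \in B ->
  (#|A :|: B| <= k.+1)%N -> (#|A| <= k)%N.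
Proof.
rewrite cardsU => /eqP-> iB; rewrite cards0 subn0 => cAB.
suff: (#|A| < k.+1)%N by [].
apply: leq_trans cAB; rewrite -addn1 leq_add2l; apply/card_gt0P; exists i.
by [].
Qed.

Lemma belowW m A : below m A -> below m.+1 A.
Proof.
by move=> bA; apply/subsetP => i iA; rewrite inE ltnW // ltnS (below_lt bA).
Qed.

End DisjointSets.

Ltac set_eq := apply/setP => ?; rewrite !inE; do ?case: (_ \in _); by [].
Ltac split_sets :=
  repeat match goal with
  | H : is_true (disj (_ :|: _) _) |- _ =>
      rewrite disjUl in H; case/andP: H => ? ?
  | H : is_true (disj _ (_ :|: _)) |- _ =>
      rewrite disjUr in H; case/andP: H => ? ?
  | H : is_true (below _ (_ :|: _)) |- _ =>
      rewrite belowU in H; case/andP: H => ? ?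
  end.
Ltac set_side :=
  split_sets;
  rewrite ?disjUl ?disjUr ?belowU ?inE;
  repeat (apply/andP; split);
  by [ | rewrite disjC | apply: belowW | apply/orP; (left + right);
       by [ | apply/orP; (left + right)] ].

Definition colour n (i j : 'I_n) : 'I_2 := if (i < j)%N then 0 else 1.

Section Trees.

Variables (n : nat) (R : comAlgType rat).
Variable L : 'I_2 -> 'I_n -> 'I_n -> R.
Hypothesis L_anti : forall c i j, L c j i = - L c i j.
Hypothesis L_square : forall c d i j, L c i j * L d i j = 0.
Hypothesis L_arnold : forall c d i j k, i != j -> j != k -> k != i ->
  L c i j * L d j k + L c j k * L d k i + L c k i * L d i j
  + (L d i j * L c j k + L d j k * L c k i + L d k i * L c i j) = 0.

Local Notation x := (L 0).
Local Notation y := (L 1).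
Implicit Types (B C : {set 'I_n}) (t u : R) (i j p r v : 'I_n).

(** At [c = d] the polarised relation [L_arnold] is twice the relation among letters of one colour,
    and 2 is invertible over the rationals. *)
Lemma L_arnold_diag c i j k : i != j -> j != k -> k != i ->
  L c i j * L c j k + L c j k * L c k i + L c k i * L c i j = 0.
Proof.
move=> ij jk ki; have /eqP := L_arnold c c ij jk ki.
by rewrite -mulr2n -scaler_nat scaler_eq0 /= => /eqP.
Qed.

Definition arrow i j : R := L (colour i j) i j.

Inductive rtree : {set 'I_n} -> 'I_n -> R -> Prop :=
| rtree1 r : rtree [set r] r 1
| rtree_graft B B' r r' p t t' :
    rtree B r t -> rtree B' r' t' -> disj B B' -> p \in B ->
    rtree (B :|: B') r (arrow p r' * t * t').

Definition trees B : R -> Prop := linspan (fun u => exists r, rtree B r u).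

Lemma rtree_trees B r t : rtree B r t -> trees B t.
Proof. by move=> tB; apply: linspan_gen; exists r. Qed.

Lemma rtree_root B r t : rtree B r t -> r \in B.
Proof. by elim=> [?|> _ rB *]; rewrite inE ?rB. Qed.

(** The edge entering [i] is either the last graft or lies inside one of the two grafted trees. In
    the second case the other tree is regrafted to the piece that it touches. *)
Lemma rtree_split B r t i : rtree B r t -> i \in B -> i != r ->
  exists B1 B2 p t1 t2, [/\ rtree B1 r t1, rtree B2 i t2 & disj B1 B2] /\
    [/\ p \in B1, B = B1 :|: B2 & t = arrow p i * t1 * t2].
Proof.
elim=> [? | {}B B' {}r r' p {}t t' tB IH tB' IH' dB pB].
  by rewrite inE => /eqP->; rewrite eqxx.
rewrite inE => /orP[iB /(IH iB)|iB' _].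
  move=> [B1 [B2 [q [t1 [t2 [[tB1 tB2 dB12] [qB1 eB et]]]]]]].
  subst B t; move: pB; rewrite inE => /orP[pB1|pB2].
    exists (B1 :|: B'), B2, q, (arrow p r' * t1 * t'), t2; split; split=> //.
    - by apply: rtree_graft => //; set_side.
    - by set_side.
    - by set_side.
    - by set_eq.
    - by ring.
  exists B1, (B2 :|: B'), q, t1, (arrow p r' * t2 * t'); split; split=> //.
  - by apply: rtree_graft => //; set_side.
  - by set_side.
  - by set_eq.
  - by ring.
have [->|ir'] := eqVneq i r'; first by exists B, B', p, t, t'.
move: (IH' iB' ir') => [B1 [B2 [q [t1 [t2 [[tB1 tB2 dB12] [qB1 eB et]]]]]]].
subst B' t'.
exists (B :|: B1), B2, q, (arrow p r' * t * t1), t2; split; split=> //.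
- by apply: rtree_graft => //; set_side.
- by set_side.
- by set_side.
- by set_eq.
- by ring.
Qed.

Lemma trees_graft B B' C r p u t : trees B u -> rtree B' r t -> disj B B' ->
  p \in B -> C = B :|: B' -> trees C (arrow p r * u * t).
Proof.
move=> tu tB' dB pB ->.
have -> : arrow p r * u * t = (arrow p r * t) * u by ring.
apply: linspan_mul tu => w [s tw].
have -> : arrow p r * t * w = arrow p r * w * t by ring.
by apply: rtree_trees (rtree_graft tw tB' dB pB).
Qed.

(** The induction on the largest label runs on this property. Both ends and the colour of the letter
    are arbitrary, unlike in a graft, where the arrow enters a root and the order of the labels
    dictates its colour. *)
Definition joinable m := forall B B' r r' t t' a b c,
  rtree B r t -> rtree B' r' t' -> disj B B' -> below m (B :|: B') ->
  a \in B -> b \in B' -> trees (B :|: B') (L c a b * t * t').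

Lemma joinable_linspan m B B' C u u' a b {c} : joinable m ->
  trees B u -> trees B' u' -> disj B B' -> below m (B :|: B') ->
  a \in B -> b \in B' -> C = B :|: B' -> trees C (L c a b * u * u').
Proof.
move=> J tu tu' dB bB aB bB' ->.
apply: linspan_mul tu' => w' [r' tw'].
have -> : L c a b * u * w' = L c a b * w' * u by ring.
apply: linspan_mul tu => w [r tw].
have -> : L c a b * w' * w = L c a b * w * w' by ring.
exact: J tw tw' _ _ _ _.
Qed.

(** * Joining trees in the presence of the largest label *)

Section TopVertex.

Variable v : 'I_n.
Hypothesis J : joinable v.

Lemma arrow_top i : (i < v)%N -> arrow i v = x i v.
Proof. by rewrite /arrow /colour => ->. Qed.

Lemma arrow_from_top i : (i < v)%N -> arrow v i = y v i.
Proof. by move=> iv; rewrite /arrow /colour ltnNge (ltnW iv). Qed.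

(** If [v] has a parent [k], the relation on [i], [k], [v] reads
    [x i v * x k v = x i k * (x k v - x i v)]. The letter [x i k] joins trees with labels below [v],
    and the subtree at [v] is then grafted at [k] or at [i]. *)
Lemma join_x_top B B' C i u s : trees B' u -> below v B' -> i \in B' ->
  trees B s -> v \in B -> below v.+1 B -> disj B' B -> C = B' :|: B ->
  trees C (x i v * u * s).
Proof.
move=> tu bB' iB' ts vB bB dB ->.
apply: linspan_mul ts => {}s [r ts].
have iv := below_lt bB' iB'.
have [rv|vr] := eqVneq v r; first subst r.
  by rewrite -arrow_top //; apply: trees_graft tu ts dB iB' _.
have [B1 [B2 [k [t1 [t2 [[tB1 tB2 dB12] [kB1 eB et]]]]]]] := rtree_split ts vB vr.
subst B s.
have vB1 := disj_notin dB12 (rtree_root tB2).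
have bB1 : below v B1 by apply: belowS vB1; set_side.
have kv := below_lt bB1 kB1.
have W : trees (B' :|: B1) (x i k * u * t1).
  apply: (joinable_linspan J tu (rtree_trees tB1)) => //; set_side.
have ik : i != k by apply: (@disj_neq _ B' B1); set_side.
have kv' : k != v by rewrite neq_ltn kv.
have vi' : v != i by rewrite neq_ltn iv orbT.
have -> : x i v * u * (arrow k v * t1 * t2) =
    arrow k v * (x i k * u * t1) * t2 - arrow i v * (x i k * u * t1) * t2.
  rewrite !arrow_top //; apply/eqP; rewrite -subr_eq0; apply/eqP.
  rewrite -(mulr0 (- u * t1 * t2)) -(L_arnold_diag 0 ik kv' vi') !(L_anti _ i v).
  by ring.
by apply: linspanB; apply: trees_graft W tB2 _ _ _; try set_eq; set_side.
Qed.

(** Induction on the size of [B']. At the root of [t] the letter is an arrow. Elsewhere the relation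
    on [i], its parent [p] and [v] moves the attachment to [p], which lies in the smaller tree
    [t1]. *)
Lemma join_y_top B B' C r i t s : rtree B' r t -> below v B' -> i \in B' ->
  trees B s -> v \in B -> below v.+1 B -> disj B' B -> C = B' :|: B ->
  trees C (y v i * t * s).
Proof.
move: {2}(#|B'|) (leqnn #|B'|) => k.
elim: k B B' C r i t s => [|k IH] B B' C r i t s.
  by rewrite leqn0 cards_eq0 => /eqP-> _ _; rewrite inE.
move=> cB' tB' bB' iB' ts vB bB dB ->.
have iv := below_lt bB' iB'.
have [ir|ir] := eqVneq i r.
  subst r; rewrite -arrow_from_top // mulrAC.
  by apply: trees_graft ts tB' _ _ _; try set_eq; set_side.
have [B1 [B2 [p [t1 [t2 [[tB1 tB2 dB12] [pB1 eB et]]]]]]] := rtree_split tB' iB' ir.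
subst B' t.
have iB2 := rtree_root tB2.
have cB1 := disj_card_lt dB12 iB2 cB'.
have pv : (p < v)%N by apply: below_lt pB1; set_side.
have pi : p != i by apply: disj_neq dB12 _ _.
have iv' : i != v by rewrite neq_ltn iv.
have vp' : v != p by rewrite neq_ltn pv orbT.
have attach1 B0 C0 s0 : trees B0 s0 -> v \in B0 -> below v.+1 B0 -> disj B1 B0 ->
    C0 = B1 :|: B0 -> trees C0 (y v p * t1 * s0).
  by move=> ts0 *; apply: (IH _ _ _ _ _ _ _ cB1 tB1 _ pB1 ts0) => //; set_side.
have T1 : trees (B1 :|: B) (y v p * t1 * s) by apply: attach1 ts _ _ _ _; set_side.
have T2 : trees (B2 :|: B) (y v i * s * t2).
  by rewrite -arrow_from_top //; apply: trees_graft ts tB2 _ _ _; try set_eq; set_side.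
have T12 : trees (B1 :|: B2 :|: B) (arrow p i * (y v p * t1 * s) * t2).
  by apply: trees_graft T1 tB2 _ _ _; try set_eq; set_side.
have T21 : trees (B1 :|: B2 :|: B) (y v p * t1 * (y v i * s * t2)).
  by apply: attach1 T2 _ _ _ _; try set_eq; set_side.
have [ltpi|ltip|/val_inj] := ltngtP p i; last by move/eqP; rewrite (negPf pi).
(* The arrow is an x, so the mixed relation is used. It also yields [y p i], which is not an arrow
   since [p < i], but which joins trees with labels below [v]. *)
- have Epi : arrow p i = x p i by rewrite /arrow /colour ltpi.
  rewrite Epi in T12 *.
  have U : trees (B1 :|: B2) (y p i * t1 * t2).
    by apply: joinable_linspan J (rtree_trees tB1) (rtree_trees tB2) _ _ _ _ _;
      set_side.
  have Ta : trees (B1 :|: B2 :|: B) (x i v * (y p i * t1 * t2) * s).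
    by apply: join_x_top U _ _ ts _ _ _ _; set_side.
  have Tc : trees (B1 :|: B2 :|: B) (x p v * (y p i * t1 * t2) * s).
    by apply: join_x_top U _ _ ts _ _ _ _; set_side.
  have Td : trees (B1 :|: B2 :|: B) (y v p * t1 * (x i v * t2 * s)).
    have X : trees (B2 :|: B) (x i v * t2 * s).
      by apply: join_x_top (rtree_trees tB2) _ _ ts _ _ _ _; set_side.
    by apply: attach1 X _ _ _ _; try set_eq; set_side.
  have Te : trees (B1 :|: B2 :|: B) (x p v * t1 * (y v i * s * t2)).
    by apply: join_x_top (rtree_trees tB1) _ _ T2 _ _ _ _; try set_eq; set_side.
  have -> : y v i * (x p i * t1 * t2) * s =
      y v p * t1 * (x i v * t2 * s) - x p v * (y p i * t1 * t2) * s
      + x i v * (y p i * t1 * t2) * s + x p v * t1 * (y v i * s * t2)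
      + x p i * (y v p * t1 * s) * t2.
    apply/eqP; rewrite -subr_eq0; apply/eqP.
    rewrite -(mulr0 (- t1 * t2 * s)) -(L_arnold 0 1 pi iv' vp') !(L_anti _ p v).
    by rewrite !(L_anti _ i v) ; ring.
  by do !apply: linspanD => //; apply: linspanN.
- have Epi : arrow p i = y p i by rewrite /arrow /colour ltnNge (ltnW ltip).
  rewrite Epi in T12 *.
  have -> : y v i * (y p i * t1 * t2) * s =
      y p i * (y v p * t1 * s) * t2 - y v p * t1 * (y v i * s * t2).
    apply/eqP; rewrite -subr_eq0; apply/eqP.
    rewrite -(mulr0 (- t1 * t2 * s)) -(L_arnold_diag 1 pi iv' vp').
    by rewrite !(L_anti _ i v); ring.
  exact: linspanB.
Qed.

Lemma join_at_top B B' C u s j {c} : trees B s -> trees B' u ->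
  v \in B -> below v.+1 B -> below v B' -> j \in B' -> disj B B' ->
  C = B :|: B' -> trees C (L c v j * s * u).
Proof.
move=> ts tu vB bB bB' jB' dB ->.
have [->|->] : c = 0 \/ c = 1.
- by case: c => [[|[|]]] //= ?; [left|right]; apply: val_inj.
- rewrite L_anti.
  have -> : - x j v * s * u = - (x j v * u * s) by ring.
  by apply: linspanN; apply: join_x_top tu _ _ ts _ _ _ _; try set_eq; set_side.
apply: linspan_mul tu => w [r tw]; rewrite mulrAC.
by apply: join_y_top tw _ _ ts _ _ _ _; try set_eq; set_side.
Qed.

(** Induction on the size of [B]. An edge of the tree is cut, namely the last graft if [v] is the
    root and the edge into [v] otherwise. The piece containing [a] is joined to [B'] first, and the
    cut edge is put back afterwards. *)
Lemma join_below_top B B' C u r s a j {c} : rtree B r s -> trees B' u ->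
  v \in B -> below v.+1 B -> below v B' -> a \in B -> j \in B' -> disj B B' ->
  C = B :|: B' -> trees C (L c a j * s * u).
Proof.
move: {2}(#|B|) (leqnn #|B|) => k.
elim: k B B' C r s u a j c => [|k IH] B B' C r s u a j c.
  by rewrite leqn0 cards_eq0 => /eqP-> _ _; rewrite inE.
move=> cB ts tu vB bB bB' aB jB' dB eC.
have [av|av] := eqVneq a v.
  by subst a; apply: join_at_top (rtree_trees ts) tu _ _ _ _ _ _.
have [rv|vr] := eqVneq v r.
  subst C; case: B r s / ts rv vB cB bB aB dB => [r <-|].
    by rewrite !inE (negPf av).
  move=> B1 B2 r r' p t1 t2 tB1 tB2 dB12 pB1 rv; subst r => vB cB bB aB dB.
  have vB1 := rtree_root tB1.
  have dB21 : disj B2 B1 by rewrite disjC.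
  have vB2 := disj_notin dB21 vB1.
  have bB2 : below v B2 by apply: belowS vB2; set_side.
  have r'B2 := rtree_root tB2.
  have cB1 := disj_card_lt dB12 r'B2 cB.
  have := aB; rewrite inE => /orP[aB1|aB2].
    have -> : L c a j * (arrow p r' * t1 * t2) * u =
      arrow p r' * (L c a j * t1 * u) * t2 by ring.
    have T : trees (B1 :|: B') (L c a j * t1 * u).
      by apply: (IH _ _ _ _ _ _ _ _ _ cB1 tB1 tu) => //; set_side.
    by apply: trees_graft T tB2 _ _ _; try set_eq; set_side.
  (* The trees obtained on [B2 :|: B'] may have a root other than [r'], so the cut arrow is put back
     by the induction hypothesis for [B1] and not by a graft. *)
  have T : trees (B2 :|: B') (L c a j * t2 * u).
    by apply: joinable_linspan J (rtree_trees tB2) tu _ _ _ _ _; set_side.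
  have -> : L c a j * (arrow p r' * t1 * t2) * u =
      arrow p r' * t1 * (L c a j * t2 * u) by ring.
  by apply: (IH _ _ _ _ _ _ _ _ _ cB1 tB1 T) => //; try set_eq; set_side.
have [B1 [B2 [p [t1 [t2 [[tB1 tB2 dB12] [pB1 eB et]]]]]]] := rtree_split ts vB vr.
subst B s C.
have vB2 := rtree_root tB2.
have vB1 := disj_notin dB12 vB2.
have bB1 : below v B1 by apply: belowS vB1; set_side.
have cB2 : (#|B2| <= k)%N.
  by apply: disj_card_lt pB1 _; [rewrite disjC | rewrite setUC].
rewrite arrow_top ?(below_lt bB1) //.
have := aB; rewrite inE => /orP[aB1|aB2].
  have -> : L c a j * (x p v * t1 * t2) * u = x p v * (L c a j * t1 * u) * t2.
    by ring.
  have T : trees (B1 :|: B') (L c a j * t1 * u).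
    by apply: joinable_linspan J (rtree_trees tB1) tu _ _ _ _ _; set_side.
  by apply: join_x_top T _ _ (rtree_trees tB2) _ _ _ _; try set_eq; set_side.
have -> : L c a j * (x p v * t1 * t2) * u = x p v * t1 * (L c a j * t2 * u).
  by ring.
have T : trees (B2 :|: B') (L c a j * t2 * u).
  by apply: (IH _ _ _ _ _ _ _ _ _ cB2 tB2 tu) => //; set_side.
by apply: join_x_top (rtree_trees tB1) _ _ T _ _ _ _; try set_eq; set_side.
Qed.

End TopVertex.

Lemma joinable_all m : joinable m.
Proof.
elim: m => [|m J] B B' r r' t t' a b c tB tB' dB bB aB bB'.
  by have := below_lt bB (_ : a \in _); rewrite inE aB => /(_ isT).
(* For [n <= m] no label equals [m], and the bound [m] already admits every label. *)
have [mn|nm] := ltnP m n; last first.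
  apply: J tB tB' dB _ aB bB'; apply/subsetP => i _; rewrite inE.
  exact: leq_trans nm.
pose v := Ordinal mn.
have [vB|vB] := boolP (v \in B).
  have vB' : v \notin B' by rewrite disjC in dB; apply: disj_notin dB vB.
  have bB'v : below v B' by apply: belowS vB'; set_side.
  apply: (@join_below_top v J _ _ _ _ _ _ _ _ _ tB (rtree_trees tB')) => //.
  by set_side.
have bBv : below v B by apply: belowS vB; set_side.
have [vB'|vB'] := boolP (v \in B').
  have -> : L c a b * t * t' = - (L c b a * t' * t) by rewrite (L_anti c b a); ring.
  apply: linspanN.
  apply: (@join_below_top v J _ _ _ _ _ _ _ _ _ tB' (rtree_trees tB)) => //.
  - by set_side.
  - by set_side.
  - by set_eq.
have bB'v : below v B' by apply: belowS vB'; set_side.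
by apply: J tB tB' dB _ aB bB'; rewrite belowU bBv.
Qed.

End Trees.

(** * Cycles and rooted forests *)

Lemma I2_cases (c d e : 'I_2) : c != d -> e = c \/ e = d.
Proof.
move=> cd; suff: (e == c) || (e == d).
  by move=> /orP[/eqP|/eqP]; [left | right].
rewrite -!val_eqE in cd *; move: (ltn_ord c) (ltn_ord d) (ltn_ord e).
by move: cd; case: c d e => [[|[|c]] ?] [[|[|d]] ?] [[|[|e]] ?].
Qed.

Section Cycles.

Variables (n : nat) (R : comAlgType rat).
Variable L : 'I_2 -> 'I_n -> 'I_n -> R.
Hypothesis L_anti : forall c i j, L c j i = - L c i j.
Hypothesis L_square : forall c d i j, L c i j * L d i j = 0.
Hypothesis L_arnold : forall c d i j k, i != j -> j != k -> k != i ->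
  L c i j * L d j k + L c j k * L d k i + L c k i * L d i j
  + (L d i j * L c j k + L d j k * L c k i + L d k i * L c i j) = 0.

Implicit Types (B : {set 'I_n}) (t : R) (a b i j p q w : 'I_n).

(** Trees without orientation: any letter may join any two vertices, and the sign absorbs the
    reversal of an edge. Such a tree can be cut at an edge of any chosen vertex. *)
Inductive utree : {set 'I_n} -> R -> Prop :=
| utree1 r : utree [set r] 1
| utreeN B t : utree B t -> utree B (- t)
| utree_join B B' p q c t t' :
    utree B t -> utree B' t' -> disj B B' -> p \in B -> q \in B' ->
    utree (B :|: B') (L c p q * t * t').

Lemma rtree_utree B r t : rtree L B r t -> utree B t.
Proof.
elim=> [?|{}B B' {}r r' p {}t t' _ ? tB' ? ? ?]; first exact: utree1.
by apply: utree_join => //; apply: rtree_root tB'.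
Qed.

(** The vertex [b] ensures that [j] has a neighbour. Either the last join ends at [j], or the part
    containing [j] has a second vertex and induction applies. *)
Lemma utree_split B t j b : utree B t -> j \in B -> b \in B -> b != j ->
  exists B1 B2 c w t1 t2, [/\ utree B1 t1, utree B2 t2 & disj B1 B2] /\
    [/\ j \in B1, w \in B2, B = B1 :|: B2 & t = L c j w * t1 * t2].
Proof.
move=> tB jB bB bj; have : exists2 i, i \in B & i != j by exists b.
elim: tB jB => {b bB bj} [r|{}B {}t _ IH jB /(IH jB)|].
- by rewrite inE => /eqP-> [i]; rewrite inE => /eqP->; rewrite eqxx.
- move=> [B1 [B2 [c [w [t1 [t2 [[tB1 tB2 dB12] [jB1 wB2 eB et]]]]]]]].
  exists B1, B2, c, w, (- t1), t2; split; split=> //; first exact: utreeN.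
  by rewrite et; ring.
move=> {}B B' p q c {}t t' tB IH tB' IH' dB pB qB' jBB' _.
(* Here [j] lies in the first of the two joined trees; the other case follows by antisymmetry of the
   joining letter. *)
have gen C C' s s' k l : utree C s -> utree C' s' -> disj C C' -> k \in C ->
    l \in C' -> (j \in C -> (exists2 i, i \in C & i != j) ->
      exists B1 B2 c w t1 t2, [/\ utree B1 t1, utree B2 t2 & disj B1 B2] /\
      [/\ j \in B1, w \in B2, C = B1 :|: B2 & s = L c j w * t1 * t2]) ->
    j \in C ->
    exists B1 B2 d w t1 t2, [/\ utree B1 t1, utree B2 t2 & disj B1 B2] /\
      [/\ j \in B1, w \in B2, C :|: C' = B1 :|: B2 &
          L c k l * s * s' = L d j w * t1 * t2].
  move=> sC sC' dC kC lC' IHC jC; have [<-|kj] := eqVneq k j.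
    by exists C, C', c, l, s, s'.
  have [|B1 [B2 [d [w [t1 [t2 [[tB1 tB2 dB12] [jB1 wB2 eC es]]]]]]]] := IHC jC.
    by exists k.
  subst C s; move: kC; rewrite inE => /orP[kB1|kB2].
    exists (B1 :|: C'), B2, d, w, (L c k l * t1 * s'), t2; split; split=> //.
    - by apply: utree_join => //; set_side.
    - by set_side.
    - by set_side.
    - by set_eq.
    - by ring.
  exists B1, (B2 :|: C'), d, w, t1, (L c k l * t2 * s'); split; split=> //.
  - by apply: utree_join => //; set_side.
  - by set_side.
  - by set_side.
  - by set_eq.
  - by ring.
move: jBB'; rewrite inE => /orP[jB|jB']; first exact: gen.
rewrite disjC in dB; have := gen _ _ _ _ _ _ tB' tB dB qB' pB IH' jB'.
move=> [B1 [B2 [d [w [t1 [t2 [[tB1 tB2 dB12] [jB1 wB2 eB et]]]]]]]].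
exists B1, B2, d, w, (- t1), t2; split; split=> //; first exact: utreeN.
  by rewrite setUC.
have -> : L c p q * t * t' = - (L c q p * t' * t) by rewrite (L_anti c p q); ring.
by rewrite et; ring.
Qed.

(** The relation on [p], [j], [b] turns the product of the two letters at [p] into a multiple of
    [L c j b]. *)
Lemma two_edges_same_colour c t p j b :
  j != p -> b != p -> (b != j -> L c j b * t = 0) ->
  L c p j * L c p b * t = 0.
Proof.
move=> jp bp Z; have [->|bj] := eqVneq b j; first by rewrite L_square mul0r.
have pj : p != j by rewrite eq_sym.
have jb : j != b by rewrite eq_sym.
have E := L_arnold_diag L_arnold c pj jb bp.
transitivity (L c j b * t * (L c p j + L c b p)
  - t * (L c p j * L c j b + L c j b * L c b p + L c b p * L c p j)).
  by rewrite (L_anti c p b); ring.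
by rewrite E Z // mul0r mulr0 subr0.
Qed.

(** A simultaneous induction. Cutting an edge at [a] turns a cycle through [a] into two edges from
    the outside vertex [a] to a smaller tree. Conversely, two edges of equal colour from [p] reduce
    to a cycle by [two_edges_same_colour]; for different colours, the relation on [p], [j] and a
    neighbour [w] of [j] leads to smaller trees. *)
Lemma cycle0_rec k :
  (forall B t a b c, (#|B| <= k)%N -> utree B t -> a \in B -> b \in B ->
    b != a -> L c a b * t = 0) /\
  (forall B t p j b c d, (#|B| <= k)%N -> utree B t -> p \notin B ->
    j \in B -> b \in B -> L c p j * L d p b * t = 0).
Proof.
elim: k => [|k [Z P]].
  have e0 B i : (#|B| <= 0)%N -> i \in B = false.
    by rewrite leqn0 cards_eq0 => /eqP->; rewrite inE.
  by split=> [B t a b c /e0 cB _|B t p j b c d /e0 cB _ _]; rewrite cB.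
have Z' B t a b c : (#|B| <= k.+1)%N -> utree B t -> a \in B -> b \in B ->
    b != a -> L c a b * t = 0.
  move=> cB tB aB bB ba.
  have [B1 [B2 [d [w [t1 [t2 [[tB1 tB2 dB12] [aB1 wB2 eB et]]]]]]]] :=
    utree_split tB aB bB ba.
  subst B t; move: bB; rewrite inE => /orP[bB1|bB2].
    transitivity (L d a w * t2 * (L c a b * t1)); first by ring.
    by rewrite (Z B1 t1 a b) ?mulr0 //; apply: disj_card_lt dB12 wB2 cB.
  have cB2 : (#|B2| <= k)%N.
    by apply: disj_card_lt aB1 _; [rewrite disjC | rewrite setUC].
  have aB2 : a \notin B2 by apply: disj_notin aB1; rewrite disjC.
  transitivity (t1 * (L c a b * L d a w * t2)); first by ring.
  by rewrite (P B2 t2 a b w) ?mulr0.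
split=> // B t p j b c d cB tB pB jB bB.
have neq_p i : i \in B -> i != p by apply: contraTneq => ->.
have same e s i l : utree B s -> i \in B -> l \in B -> L e p i * L e p l * s = 0.
  move=> sB iB lB; apply: two_edges_same_colour; rewrite ?neq_p // => ?.
  exact: (Z' B).
have [<-|cd] := eqVneq c d; first exact: same.
have [->|bj] := eqVneq b j; first by rewrite L_square mul0r.
have [B1 [B2 [e [w [t1 [t2 [[tB1 tB2 dB12] [jB1 wB2 eB et]]]]]]]] :=
  utree_split tB jB bB bj.
have pj : p != j by rewrite eq_sym neq_p.
have jw : j != w by apply: disj_neq dB12 _ _.
have wp : w != p by rewrite neq_p // eB inE wB2 orbT.
subst B t; move: pB bB; rewrite !inE => /norP[pB1 pB2] /orP[bB1|bB2].
  transitivity (L e j w * t2 * (L c p j * L d p b * t1)); first by ring.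
  by rewrite (P B1 t1 p j b) ?mulr0 //; apply: disj_card_lt dB12 wB2 cB.
have cB2 : (#|B2| <= k)%N.
  by apply: disj_card_lt jB1 _; [rewrite disjC | rewrite setUC].
have PB2 l m : L l p w * L m p b * t2 = 0 by apply: (P B2).
have [ec|ed] := I2_cases e cd; [subst e | subst e].
- have E := L_arnold_diag L_arnold c pj jw wp.
  transitivity (t1 * (L c j w + L c p j) * (L c p w * L d p b * t2) +
    t1 * t2 * L d p b *
      (L c p j * L c j w + L c j w * L c w p + L c w p * L c p j)).
    by rewrite (L_anti c p w); ring.
  by rewrite E PB2 !mulr0 addr0.
have E := L_arnold c d pj jw wp.
(* The tree with the edge from [j] to [w] recoloured by [c]; the two letters at [p] now share the
   colour [d]. *)
have S : L d p j * L d p b * (L c j w * t1 * t2) = 0.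
  by apply: same => //; [apply: utree_join | rewrite inE bB2 orbT].
transitivity (t1 * t2 * L d p b *
    (L c p j * L d j w + L c j w * L d w p + L c w p * L d p j
     + (L d p j * L c j w + L d j w * L c w p + L d w p * L c p j))
  + t1 * (L c j w + L c p j) * (L d p w * L d p b * t2)
  + t1 * (L d p j + L d j w) * (L c p w * L d p b * t2)
  - L d p j * L d p b * (L c j w * t1 * t2)).
  by rewrite (L_anti c p w) (L_anti d p w); ring.
by rewrite E S !PB2 !mulr0 subr0 !addr0.
Qed.

Lemma cycle0 B r t a b c : rtree L B r t -> a \in B -> b \in B -> b != a ->
  L c a b * t = 0.
Proof.
move=> /rtree_utree tB aB bB ba.
by have [Z _] := cycle0_rec #|B|; apply: Z tB aB bB ba.
Qed.

End Cycles.

(** * Forest monomials and their parent functions *)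

Section Forests.

Variables (n : nat) (R : comAlgType rat).
Variable L : 'I_2 -> 'I_n -> 'I_n -> R.

Implicit Types (B : {set 'I_n}) (t f u : R) (a b i j p q r : 'I_n).

Inductive forest : {set 'I_n} -> R -> Prop :=
| forest0 : forest set0 1
| forestU B B' r t f :
    rtree L B r t -> forest B' f -> disj B B' -> forest (B :|: B') (t * f).

Lemma forest_split B u a : forest B u -> a \in B ->
  exists B1 B2 r t f, [/\ rtree L B1 r t, forest B2 f & disj B1 B2] /\
    [/\ a \in B1, B = B1 :|: B2 & u = t * f].
Proof.
elim=> [|{}B B' r t f tB fB' IH dB]; first by rewrite inE.
rewrite inE; case aB: (a \in B) => /=; first by exists B, B', r, t, f.
move/IH => [B1 [B2 [r' [t' [f' [[tB1 fB2 dB12] [aB1 eB et]]]]]]]; subst B' f.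
exists B1, (B :|: B2), r', t', (t * f'); split; split=> //.
- by apply: forestU tB fB2 _; set_side.
- by set_side.
- by set_eq.
- by rewrite mulrCA.
Qed.

Lemma forest1 B : forest B 1.
Proof.
have [k] := ubnP #|B|; elim: k B => // k IH B.
have [->|[a aB]] := set_0Vmem B; first by move=> _; apply: forest0.
rewrite -{2}(setD1K aB) (cardsD1 a) aB add1n ltnS => /IH fB.
rewrite -[1]mulr1; apply: forestU (rtree1 L a) fB _.
by rewrite /disj setI_eq0 disjoints1 !inE eqxx.
Qed.

Section Letter.

Hypothesis L_anti : forall c i j, L c j i = - L c i j.
Hypothesis L_square : forall c d i j, L c i j * L d i j = 0.
Hypothesis L_arnold : forall c d i j k, i != j -> j != k -> k != i ->
  L c i j * L d j k + L c j k * L d k i + L c k i * L d i j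
  + (L d i j * L c j k + L d j k * L c k i + L d k i * L c i j) = 0.

(** A letter inside a component gives 0 by [cycle0]; a letter between two components merges them by
    [joinable_all]. *)
Lemma forest_letter u c a b : linspan (forest setT) u ->
  linspan (forest setT) (L c a b * u).
Proof.
apply: linspan_mul => {}u fu; have [->|ba] := eqVneq b a.
  have /eqP : L c a a *+ 2 = 0 by rewrite mulr2n [X in _ + X]L_anti subrr.
  by rewrite -scaler_nat scaler_eq0 /= => /eqP->; rewrite mul0r; apply: linspan0.
have [B1 [B2 [r [t [f [[tB1 fB2 dB12] [aB1 eB ->]]]]]]] := forest_split fu (in_setT a).
have : b \in B1 :|: B2 by rewrite -eB inE.
rewrite inE mulrA => /orP[bB1|bB2].
  by rewrite (cycle0 L_anti L_square L_arnold c tB1) // mul0r; apply: linspan0.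
have [B3 [B4 [r' [t' [f' [[tB3 fB4 dB34] [bB3 eB2 ->]]]]]]] := forest_split fB2 bB2.
subst B2; split_sets.
have T : trees L (B1 :|: B3) (L c a b * t * t').
  apply: (joinable_all L_anti L_arnold (m := n) c tB1 tB3) => //.
  by apply/subsetP => i _; rewrite inE ltn_ord.
have -> : L c a b * t * (t' * f') = f' * (L c a b * t * t') by ring.
apply: linspan_mul T => w [s tw]; rewrite mulrC eB setUA.
by apply/linspan_gen/(forestU tw fB4); set_side.
Qed.

End Letter.

Implicit Types (P : {ffun 'I_n -> option 'I_n}) (rk : 'I_n -> nat).

(* A rooted forest is encoded by its parent function, None marking a root. *)
Definition pmono P : R := \prod_j oapp (fun i => arrow L i j) 1 (P j).

(** A rank increasing along the arrows certifies acyclicity and extends easily when two forests are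
    joined. *)
Definition ranked_in B P rk :=
  forall i j, P j = Some i -> [/\ i \in B, j \in B & (rk i < rk j)%N].

(** One construction serves twice: [e = None] is a disjoint union, and [e = Some (i, j)] is a graft
    at [i] of the tree with root [j]. *)
Lemma ranked_join B B' P P' rk rk' (e : option ('I_n * 'I_n)) :
  disj B B' -> ranked_in B P rk -> ranked_in B' P' rk' ->
  (forall i j, e = Some (i, j) -> [/\ i \in B, j \in B' & P' j = None]) ->
  exists P2 rk2, [/\ ranked_in (B :|: B') P2 rk2,
    forall r, P r = None -> r \notin B' -> P2 r = None &
    pmono P2 = oapp (fun ij => arrow L ij.1 ij.2) 1 e * pmono P * pmono P'].
Proof.
move=> dB rP rP' he.
have PB j : j \notin B -> P j = None.
  by case E: (P j) => [i|//]; have [_ ->] := rP _ _ E.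
have PB' j : j \notin B' -> P' j = None.
  by case E: (P' j) => [i|//]; have [_ ->] := rP' _ _ E.
have nB j : j \in B' -> j \notin B by apply: disj_notin.
have nB' j : j \in B -> j \notin B' by apply: disj_notin; rewrite disjC.
pose P2 := [ffun j => if j \in B' then
  (if e is Some (i, r) then if j == r then Some i else P' j else P' j) else P j].
(* The shift by [\sum_i rk i] puts every rank on [B'] above every rank on [B], so a new arrow from
   [B] to [B'] increases the rank. *)
exists P2, (fun j => if j \in B' then (\sum_i rk i + (rk' j).+1)%N else rk j).
split.
- move=> i j; rewrite ffunE; case: ifPn => jB'; last first.
    move=> /rP[iB jB rij]; rewrite !inE iB jB; split=> //.
    by rewrite ifN // nB'.
  have old : P' j = Some i -> [/\ i \in B :|: B', j \in B :|: B' &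
     ((if i \in B' then (\sum_i rk i + (rk' i).+1)%N else rk i) <
        \sum_i rk i + (rk' j).+1)%N].
    by move=> /rP'[iB' _ rij]; rewrite !inE iB' jB' !orbT ltn_add2l.
  case: e he {P2} => [[k r] /(_ _ _ erefl)[kB rB' P'r]|_]; last exact: old.
  case: eqP => [->[<-]|_]; last exact: old.
  rewrite !inE kB rB' orbT ifN ?nB' //; split=> //.
  by rewrite (bigD1 k) //= addnS ltnS -addnA leq_addr.
- by move=> r Pr rB'; rewrite ffunE (negPf rB').
rewrite -mulrA -big_split /=.
case: e he @P2 => [[i r] /(_ _ _ erefl)[iB rB' P'r]|_] P2 /=.
  rewrite /pmono (bigD1 r) //= [in RHS](bigD1 r) //= mulrA ffunE rB' eqxx.
  rewrite P'r PB ?nB //= !mulr1; congr (_ * _); apply: eq_bigr => j jr.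
  rewrite ffunE (negPf jr); case: ifPn => [jB'|/PB'->]; last by rewrite mulr1.
  by rewrite PB ?nB //= mul1r.
rewrite mul1r; apply: eq_bigr => j _; rewrite ffunE.
case: ifPn => [jB'|/PB'->]; last by rewrite mulr1.
by rewrite PB ?nB //= mul1r.
Qed.

Lemma pmono_none : pmono [ffun=> None] = 1.
Proof. by rewrite /pmono big1 // => j _; rewrite ffunE. Qed.

Lemma rtree_ranked B r t : rtree L B r t ->
  exists P rk, [/\ ranked_in B P rk, P r = None & t = pmono P].
Proof.
elim=> [{}r|{}B B' {}r r' p {}t t' tB IH tB' IH' dB pB].
  exists [ffun=> None], (fun=> 0%N); rewrite pmono_none ffunE; split=> //.
  by move=> i j; rewrite ffunE.
have [P [rk [rP Pr ->]]] := IH; have [P' [rk' [rP' Pr' ->]]] := IH'.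
have [i j [<- <-]|P2 [rk2 [rP2 P2r eP2]]] :=
    ranked_join (e := Some (p, r')) dB rP rP'.
  by split=> //; apply: rtree_root tB'.
exists P2, rk2; split=> //; apply: P2r => //.
by apply: disj_notin (rtree_root tB); rewrite disjC.
Qed.

Lemma forest_ranked B u : forest B u ->
  exists P rk, ranked_in B P rk /\ u = pmono P.
Proof.
elim=> [|{}B B' r t f tB fB' [P' [rk' [rP' ->]]] dB].
  exists [ffun=> None], (fun=> 0%N); rewrite pmono_none; split=> //.
  by move=> i j; rewrite ffunE.
have [P [rk [rP _ ->]]] := rtree_ranked tB.
have [//|P2 [rk2 [rP2 _ e]]] := ranked_join (e := None) dB rP rP'.
by exists P2, rk2; split=> //; rewrite e mul1r.
Qed.

End Forests.

(** * Parent functions *)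

Section ParentFunctions.

Variable n : nat.
Implicit Types (A B U : {set 'I_n}) (P Q G : {ffun 'I_n -> option 'I_n}).
Implicit Types (i j u v w : 'I_n).

Definition child P : rel 'I_n := fun i j => P j == Some i.
Definition desc P v := [set u | connect (child P) v u].
Definition acyclic P :=
  [forall j, if P j is Some i then i \notin desc P j else true].
Definition within A P :=
  [forall j, if P j is Some i then (i \in A) && (j \in A) else true].

Lemma acyclicP P :
  reflect (forall i j, P j = Some i -> i \notin desc P j) (acyclic P).
Proof.
apply: (iffP forallP) => [aP i j Pj|aP j]; first by have := aP j; rewrite Pj.
by case Pj: (P j) => [i|//]; apply: aP.
Qed.

Lemma withinP A P :
  reflect (forall i j, P j = Some i -> i \in A /\ j \in A) (within A P).
Proof.
apply: (iffP forallP) => [aP i j Pj|aP j].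
  by have := aP j; rewrite Pj => /andP.
by case Pj: (P j) => [i|//]; apply/andP/aP.
Qed.

Lemma desc_refl P v : v \in desc P v.
Proof. by rewrite inE. Qed.

Lemma desc_child P v i j : i \in desc P v -> P j = Some i -> j \in desc P v.
Proof.
rewrite !inE => vi Pj; apply: connect_trans vi (connect1 _).
by rewrite /child Pj.
Qed.

Lemma desc_parent P v j : j \in desc P v -> j != v ->
  exists2 i, P j = Some i & i \in desc P v.
Proof.
rewrite inE => /connectP[s]; case/lastP: s => [_ ->|s k]; first by rewrite eqxx.
rewrite last_rcons rcons_path => /andP[ps /eqP Pk] -> _.
by exists (last v s); rewrite // inE; apply/connectP; exists s.
Qed.

Lemma desc_parent_in P v i j : P j = Some i -> j \in desc P v -> j != v ->
  i \in desc P v.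
Proof. by move=> Pj vj /(desc_parent vj)[k]; rewrite Pj => -[<-]. Qed.

Lemma desc_ind P v (S : 'I_n -> Prop) : S v ->
  (forall i j, i \in desc P v -> S i -> P j = Some i -> S j) ->
  forall j, j \in desc P v -> S j.
Proof.
move=> Sv Sstep j; rewrite inE => /connectP[s].
elim/last_ind: s j => [|s k IH] j; first by move=> _ ->.
rewrite last_rcons rcons_path => /andP[ps /eqP Pk] ->.
apply: Sstep Pk; last exact: IH.
by rewrite inE; apply/connectP; exists s.
Qed.

Lemma desc_within A P v j : within A P -> v \in A -> j \in desc P v -> j \in A.
Proof.
move=> /withinP PA vA; apply: (@desc_ind P v (fun j => j \in A)) => //.
by move=> i k _ _ /PA[].
Qed.

Lemma ranked_acyclic P (rk : 'I_n -> nat) :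
  (forall i j, P j = Some i -> (rk i < rk j)%N) -> acyclic P.
Proof.
move=> rP; apply/acyclicP => i j /rP rij; apply/negP => ji.
suff : (rk j <= rk i)%N by rewrite leqNgt rij.
move: ji; apply: (@desc_ind P j (fun i => (rk j <= rk i)%N)) => // k l _ jk.
by move=> /rP/ltnW; apply: leq_trans jk.
Qed.

(** Edges are recorded by their heads, which determine them because a vertex has at most one
    parent. *)
Definition cross B P :=
  [set j | if P j is Some i then (i \in B) != (j \in B) else false].
Definition cut B P := [ffun j => if j \in cross B P then None else P j].

Lemma crossP B P j :
  reflect (exists2 i, P j = Some i & (i \in B) != (j \in B)) (j \in cross B P).
Proof.
rewrite inE; case Pj: (P j) => [i|]; last by right=> -[].
by apply: (iffP idP) => [iB|[k [->]]//]; exists i.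
Qed.

Lemma cut_eq_noncross B P Q j : cut B Q = cut B P -> j \notin cross B Q ->
  Q j = if j \in cross B P then None else P j.
Proof. by move=> /ffunP/(_ j); rewrite !ffunE => + /negPf jQ; rewrite jQ. Qed.

Lemma cut_eq_cross B P Q j : cut B Q = cut B P -> j \in cross B Q ->
  j \notin cross B P -> P j = None.
Proof.
by move=> /ffunP/(_ j); rewrite !ffunE => + jQ /negPf jP; rewrite jQ jP.
Qed.

Lemma cut_eq_same_cross B P Q j : cut B Q = cut B P ->
  cross B P = [set j] -> cross B Q = [set j] -> Q j = P j -> Q = P.
Proof.
move=> PQ cP cQ Qj; apply/ffunP => k; have [->//|kj] := eqVneq k j.
by rewrite (cut_eq_noncross PQ) ?cP ?cQ inE (negPf kj).
Qed.

(** The coefficient of the variable of the top node in the letter from [i] to [j]: the sign is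
    positive when the arrow leaves the left side [B]. *)
Definition edge_weight (k : option 'I_2) B i j : rat :=
  if k == Some (colour i j) then (if i \in B then 1 else -1) else 0.

(* The factor contributed by the top node to the functional of a bracketing
   with leaves B on the left; its colour k = None stands for no bracket. *)
Definition split_weight k B P : rat :=
  (#|cross B P| == (k != None))%:R *
  \prod_(j in cross B P) oapp (edge_weight k B ^~ j) 1 (P j).

Lemma split_weight_none B P : split_weight None B P = (cross B P == set0)%:R.
Proof.
rewrite /split_weight cards_eq0; case: eqP => [->|_]; last by rewrite mul0r.
by rewrite big_set0 mulr1.
Qed.

Lemma split_weight_some c B P j i : cross B P = [set j] -> P j = Some i ->
  split_weight (Some c) B P = edge_weight (Some c) B i j.
Proof.
by move=> cP Pj; rewrite /split_weight cP cards1 big_set1 Pj mul1r.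
Qed.

Lemma edge_weight_neq0 c B i j : (edge_weight (Some c) B i j != 0) =
  (c == colour i j).
Proof.
rewrite /edge_weight (inj_eq Some_inj); case: (c == _); last by rewrite eqxx.
by case: ifP.
Qed.

Lemma split_weight_neq0 c B P : split_weight (Some c) B P != 0 ->
  exists j i, [/\ cross B P = [set j], P j = Some i,
                  (i \in B) != (j \in B) & c = colour i j].
Proof.
move=> wP; have cP : #|cross B P| == 1%N.
  by apply: contraNT wP => /negPf cP; rewrite /split_weight cP mul0r.
have /cards1P[j cj] := cP.
have : j \in cross B P by rewrite cj inE.
move=> /crossP[i Pj ij]; exists j, i; split=> //; apply/eqP.
by rewrite -(edge_weight_neq0 c B) -(split_weight_some _ cj Pj).
Qed.

(** [cut B P] fixes the pieces on [B] and on its complement, so the sum runs over the ways of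
    joining them. For [k = Some c] only a single joining arrow of colour [c] counts; for [k = None]
    only the disjoint union does. *)
Definition split_sum f A B k P : rat :=
  \sum_(Q | within A Q && (cut B Q == cut B P)) f Q * split_weight k B Q.

Definition splits_vanish f A := forall B k P, within A P ->
  B \subset A -> B != set0 -> B != A -> split_sum f A B k P = 0.

Lemma split_sum_solo f A B k P : within A P ->
  split_sum f A B k P = 0 -> split_weight k B P != 0 ->
  (forall Q, within A Q -> cut B Q = cut B P -> split_weight k B Q != 0 ->
     Q != P -> f Q = 0) -> f P = 0.
Proof.
move=> PA E wP h; move/eqP: E; rewrite /split_sum (bigD1 P) ?PA ?eqxx //=.
rewrite big1 => [|Q /andP[/andP[QA /eqP cQ] QP]].
  by rewrite addr0 mulf_eq0 (negPf wP) orbF => /eqP.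
have [->|wQ] := eqVneq (split_weight k B Q) 0; first by rewrite mulr0.
by rewrite h // mul0r.
Qed.

(** Without crossing arrows the two pieces determine the whole, so the identity for [k = None]
    reduces to [f P]. *)
Lemma split_none_vanish f A B P : splits_vanish f A -> within A P ->
  B \subset A -> B != set0 -> B != A -> cross B P = set0 -> f P = 0.
Proof.
move=> sf PA BA B0 BnA cP; apply: (split_sum_solo PA (sf B None P PA BA B0 BnA)).
  by rewrite split_weight_none cP eqxx oner_eq0.
move=> Q QA PQ; rewrite split_weight_none; have [cQ _|//] := eqVneq (cross B Q) set0.
case/eqP; apply/ffunP => j.
by rewrite (cut_eq_noncross PQ) ?cQ ?cP ?inE.
Qed.

End ParentFunctions.

(** * The split identities force vanishing *)

Section Vanishing.

Variable n : nat.
Implicit Types (A B U : {set 'I_n}) (P Q G : {ffun 'I_n -> option 'I_n}).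
Implicit Types (i j u v w : 'I_n) (f : {ffun 'I_n -> option 'I_n} -> rat).

Lemma cross_desc P v j : j \in cross (desc P v) P -> j = v.
Proof.
move=> /crossP[i Pj iNj]; apply: contraTeq iNj => jv; rewrite negbK; apply/eqP.
by apply/idP/idP => [/desc_child/(_ Pj)//|jD]; apply: desc_parent_in Pj jD jv.
Qed.

Lemma cross_desc_nonroot P v i : P v = Some i -> i \notin desc P v ->
  cross (desc P v) P = [set v].
Proof.
move=> Pv iD; apply/setP => j; rewrite in_set1; apply/idP/eqP => [/cross_desc//|->].
by apply/crossP; exists i => //; rewrite desc_refl (negPf iD).
Qed.

Section Top.

Variables (f : {ffun 'I_n -> option 'I_n} -> rat) (A : {set 'I_n}) (v : 'I_n).
Hypothesis (vA : v \in A) (v_max : forall j, j \in A -> (j <= v)%N).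
Hypothesis (A_gt1 : (1 < #|A|)%N) (sf : splits_vanish f A).

(** Induction on the number of children of [v]. If there are none, [v] is isolated and the
    uncoloured split at [v] applies. Otherwise the split at the subtree of a child [j], with the
    colour 1 of the arrow from [v] to [j], relates [P] to forests in which [v] is a root with fewer
    children. *)
Lemma root_top_vanish P : within A P -> P v = None -> f P = 0.
Proof.
have [k] := ubnP #|[set j | P j == Some v]|.
elim: k P => // k IH P; rewrite ltnS => cP PA Pv.
have [c0|[j]] := set_0Vmem [set j | P j == Some v].
  have nP j : P j == Some v = false.
    by apply/negbTE/negP => Pj; have := in_set0 j; rewrite -c0 inE Pj.
  apply: (split_none_vanish sf PA (B := [set v])).
  - by rewrite sub1set.
  - by apply/set0Pn; exists v; rewrite inE.
  - by apply: contraTneq A_gt1 => <-; rewrite cards1.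
  apply/setP => j; rewrite in_set0; apply/negP => /crossP[i Pj].
  rewrite !inE; have [iv|_] := eqVneq i v; first by have := nP j; rewrite Pj iv eqxx.
  by have [jv _|//] := eqVneq j v; rewrite jv Pv in Pj.
rewrite inE => /eqP Pj; set D := desc P j.
have vj : v != j by apply: contraTneq isT => vj; rewrite -vj Pv in Pj.
have vD : v \notin D by apply/negP => /desc_parent/(_ vj)[i]; rewrite Pv.
have jA : j \in A by have [] := withinP _ _ PA _ _ Pj.
have jD : j \in D by apply: desc_refl.
have cj : cross D P = [set j] by apply: cross_desc_nonroot Pj vD.
have col : colour v j = 1 by rewrite /colour ltnNge v_max.
have sD : D \subset A by apply/subsetP => u; apply: desc_within.
have D0 : D != set0 by apply/set0Pn; exists j.
have DA : D != A by apply: contraNneq vD => ->.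
apply: (split_sum_solo PA (sf (Some 1) PA sD D0 DA)) => [|Q QA PQ].
  by rewrite (split_weight_some _ cj Pj) edge_weight_neq0 col.
move=> /split_weight_neq0[j2 [i2 [cj2 Qj2 cr2]]].
rewrite /colour; case: ltnP => // ji2 _ QP.
have noncross u : u != j2 -> Q u = if u == j then None else P u.
  by move=> uj2; rewrite (cut_eq_noncross PQ) ?cj ?cj2 inE.
have [i2A j2A] := withinP _ _ QA _ _ Qj2.
(* An arrow of colour 1 goes down in label, so it cannot enter the maximum [v], which therefore
   remains a root in [Q]. *)
have vj2 : v != j2.
  apply/negP => /eqP vj2; move: cr2; have -> : i2 = j2; last by rewrite eqxx.
  by apply: val_inj; apply/eqP; rewrite eqn_leq ji2 -vj2 v_max.
(* A joining arrow that leaves [v] must enter [D] at its root [j], and then [Q] is [P]. *)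
have Qj_neq : Q j2 = Some v -> j2 = j.
  move=> Qv; apply: contraTeq (cr2) => j2j; rewrite negbK.
  have i2v : i2 = v by rewrite Qv in Qj2; case: Qj2.
  rewrite i2v (negPf vD) eq_sym eqbF_neg; apply/negP => j2D.
  have [i Pj2 _] := desc_parent j2D j2j.
  by rewrite (cut_eq_cross PQ) ?cj2 ?cj ?inE // in Pj2.
have Qj_not : Q j != Some v.
  apply/eqP => Qj; case/eqP: QP; have j2j : j2 = j.
    apply/eqP; apply: contraT => j2j; have := noncross j.
    by rewrite eq_sym eqxx => /(_ j2j); rewrite Qj.
  by apply: (cut_eq_same_cross PQ cj); rewrite -?j2j // j2j Qj Pj.
apply: IH => //; last by rewrite noncross // (negPf vj).
apply: leq_trans cP; apply: proper_card; apply/properP; split; last first.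
  by exists j; rewrite inE ?Pj.
apply/subsetP => u; rewrite !inE => /eqP Qu.
have uj2 : u != j2.
  by apply/negP => /eqP uj2; move: Qj_not; rewrite -(Qj_neq _) -uj2 Qu ?eqxx.
by move: Qu; rewrite noncross //; case: eqP => // _ ->.
Qed.

Hypothesis f_acyclic : forall P, within A P -> ~~ acyclic P -> f P = 0.
Hypothesis IHA : forall A' f', (1 < #|A'|)%N -> (#|A'| < #|A|)%N ->
  splits_vanish f' A' ->
  (forall P, within A' P -> ~~ acyclic P -> f' P = 0) ->
  forall P, within A' P -> f' P = 0.

Section Glue.

Variables (P : {ffun 'I_n -> option 'I_n}) (i : 'I_n).
Hypothesis (PA : within A P) (Pv : P v = Some i) (iU : i \notin desc P v).
Hypothesis larger_vanish : forall Q, within A Q -> Q v = Some i ->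
  (#|desc P v| < #|desc Q v|)%N -> f Q = 0.

Local Notation U := (desc P v).
Local Notation A0 := (A :\: U).

(** The subtree of [P] at [v], together with the arrow from [i] to [v], is frozen while the parent
    function on [A0] varies; [outside] recovers the latter. *)
Definition glue G := [ffun j => if j \in U then P j else G j].
Definition outside Q :=
  [ffun j => if (j \in U) || (oapp (mem U) false (Q j)) then None else Q j].

Lemma desc_top_sub : U \subset A.
Proof. by apply/subsetP => u; apply: desc_within. Qed.

Lemma outer_in : i \in A0.
Proof. by rewrite in_setD iU; have [] := withinP _ _ PA _ _ Pv. Qed.

Lemma within_glue G : within A0 G -> within A (glue G).
Proof.
move=> /withinP GA; apply/withinP => k j; rewrite ffunE.
case: ifP => [_ /(withinP _ _ PA)//|_ /GA[]].
by rewrite !in_setD => /andP[_ ->] /andP[_ ->].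
Qed.

Lemma within_outside Q : within A Q -> within A0 (outside Q).
Proof.
move=> /withinP QA; apply/withinP => k j; rewrite ffunE !in_setD.
case jU: (j \in U) => //=; case E: (Q j) => [l|//] /=.
by case: ifPn => // lU [<-]; have [lA jA] := QA _ _ E; rewrite lA jA !andbT.
Qed.

Lemma glueK G : within A0 G -> outside (glue G) = G.
Proof.
move=> /withinP GA; apply/ffunP => j; rewrite !ffunE.
have [jU|jU] := boolP (j \in U) => /=.
  by case E: (G j) => [k|//]; have [_] := GA _ _ E; rewrite in_setD jU.
case E: (G j) => [k|//] /=; have [kA _] := GA _ _ E.
by move: kA; rewrite !in_setD => /andP[/negPf kU _]; rewrite ifF.
Qed.

Lemma glue_outside : glue (outside P) = P.
Proof.
apply/ffunP => j; rewrite !ffunE; have [//|jU] := boolP (j \in U).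
case E: (P j) => [k|//] /=; case: ifP => // kU.
by have := desc_child kU E; rewrite (negPf jU).
Qed.

Lemma glue_acyclic G : within A0 G -> acyclic (glue G) -> acyclic G.
Proof.
move=> /withinP GA /acyclicP aG; apply/acyclicP => k j Gj.
have sub a b : G b = Some a -> glue G b = Some a.
  move=> Gb; have [_] := GA _ _ Gb; rewrite in_setD => /andP[/negPf bU _].
  by rewrite ffunE bU.
have := aG _ _ (sub _ _ Gj); apply: contra.
apply: (@desc_ind _ G j (fun k => k \in desc (glue G) j)); first exact: desc_refl.
by move=> a b _ aD /sub; apply: desc_child.
Qed.

(** A split of [A0] extends to [A] by putting all of [U] on the side of [i], so that no frozen arrow
    crosses. The split sum over [A] has further terms, in which an arrow leaves [U]; there the
    subtree at [v] is larger and [larger_vanish] applies. *)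
Lemma glue_splits_vanish : splits_vanish (f \o glue) A0.
Proof.
move=> B k G0 G0A BA B0 BA0.
pose B' := if i \in B then B :|: U else B.
have B'U j : j \in U -> (j \in B') = (i \in B).
  move=> jU; rewrite /B'; case: ifP => iB; rewrite ?in_setU ?jU ?orbT //.
  by apply: contraTF jU => /(subsetP BA); rewrite in_setD => /andP[].
have B'A j : j \in A0 -> (j \in B') = (j \in B).
  rewrite /B'; case: ifP => iB; rewrite ?in_setU // in_setD => /andP[/negPf->].
  by rewrite orbF.
have iA0 := outer_in.
have parU j : j \in U -> exists2 l, P j = Some l & (l \in B') = (j \in B').
  move=> jU; have [->|jv] := eqVneq j v.
    by exists i; rewrite // B'A // B'U ?desc_refl.
  by have [l Pj lU] := desc_parent jU jv; exists l; rewrite // !B'U.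
have crossE G : within A0 G -> cross B' (glue G) = cross B G.
  move=> /withinP GA; apply/setP => j; rewrite [LHS]inE [RHS]inE ffunE.
  have [jU|jU] := boolP (j \in U).
    have [l -> ->] := parU _ jU; rewrite eqxx.
    by case E: (G j) => [a|//]; have [_] := GA _ _ E; rewrite in_setD jU.
  by case E: (G j) => [a|//]; have [aA jA] := GA _ _ E; rewrite !B'A.
have weightE G : within A0 G -> split_weight k B' (glue G) = split_weight k B G.
  move=> GA; rewrite /split_weight crossE //; congr (_ * _).
  apply: eq_bigr => j /crossP[a Gj _]; have [aA] := withinP _ _ GA _ _ Gj.
  by rewrite in_setD => /andP[/negPf jU _]; rewrite ffunE jU Gj /= /edge_weight B'A.
have cutE G : within A0 G -> cut B' (glue G) = glue (cut B G).
  move=> GA; apply/ffunP => j; rewrite !ffunE crossE //.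
  case: ifP => //; case: ifP => // jU /crossP[a Ga _].
  by have [_] := withinP _ _ GA _ _ Ga; rewrite in_setD jU.
have cut_within G : within A0 G -> within A0 (cut B G).
  move=> /withinP GA; apply/withinP => a b; rewrite ffunE.
  by case: ifP => // _; apply: GA.
have B'sub : B' \subset A.
  have BA' : B \subset A by apply: subset_trans BA (subsetDl _ _).
  by rewrite /B'; case: ifP => // _; rewrite subUset BA' desc_top_sub.
have B'0 : B' != set0.
  by have [b bB] := set0Pn _ B0; apply/set0Pn; exists b; rewrite B'A ?(subsetP BA).
have B'nA : B' != A.
  apply: contraNneq BA0 => eB; rewrite eqEsubset BA /=; apply/subsetP => j jA0.
  by rewrite -(B'A _ jA0) eB; move: jA0; rewrite in_setD => /andP[].
have := sf k (within_glue G0A) B'sub B'0 B'nA.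
rewrite /split_sum (bigID (fun Q => Q == glue (outside Q))) /=.
rewrite [X in _ + X]big1 ?addr0 => [E|Q /andP[/andP[QA /eqP cQ] Qnot]]; last first.
  have QU j : j \in U -> Q j = P j.
    move=> jU; have [l Pj lj] := parU _ jU.
    have gj : glue G0 j = Some l by rewrite ffunE jU.
    have ncj : j \notin cross B' (glue G0).
      by apply/negP => /crossP[m]; rewrite gj => -[<-]; rewrite lj eqxx.
    have [jc|jc] := boolP (j \in cross B' Q).
      by have := cut_eq_cross cQ jc ncj; rewrite gj.
    by rewrite (cut_eq_noncross cQ jc) (negPf ncj) gj Pj.
  have UQ : U \subset desc Q v.
    apply/subsetP; apply: (@desc_ind _ P v (fun j => j \in desc Q v)).
      exact: desc_refl.
    by move=> a b aU aQ Pb; apply: desc_child aQ _; rewrite QU // (desc_child aU Pb).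
  have [j jU [a aU Qj]] : exists2 j, j \notin U & exists2 a, a \in U & Q j = Some a.
    have : [exists j, (j \notin U) && (oapp (mem U) false (Q j))].
      apply: contraR Qnot; rewrite negb_exists => /forallP h.
      apply/eqP/ffunP => j; rewrite !ffunE; have := h j.
      by have [/QU->//|_ /= /negPf ->] := boolP (j \in U).
    move=> /existsP[j /andP[jU]]; case E: (Q j) => [a|//] /= aU.
    by exists j => //; exists a.
  rewrite larger_vanish ?mul0r //; first by rewrite QU ?desc_refl.
  apply: proper_card; apply/properP; split=> //; exists j => //.
  by apply: desc_child Qj; apply: (subsetP UQ).
rewrite -[RHS]E [RHS](reindex_onto glue outside) /=; last first.
  by move=> Q /andP[_ /eqP <-].
apply: eq_big => [G|G /andP[GA _]]; last by rewrite weightE.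
apply/andP/andP => [[GA /eqP cG]|[/andP[/andP[GA /eqP cG] _] /eqP oG]].
  by rewrite glueK // !eqxx within_glue // !cutE // cG eqxx.
have GA0 : within A0 G by rewrite -oG; apply: within_outside.
rewrite GA0; split=> //; apply/eqP.
by rewrite -(glueK (cut_within _ GA0)) -cutE // cG cutE // glueK // cut_within.
Qed.

(** If [A0] has at least two elements, the induction on the size of [A] applies to [f \o glue]. If
    [A0] consists of [i] alone, the split at [U] with colour 0 involves, besides [P], only parent
    functions for which [v] is a root. *)
Lemma nonroot_top_vanish : f P = 0.
Proof.
have iA0 := outer_in; have sU := desc_top_sub; have vU := desc_refl P v.
have [A0_gt1|A0_le1] := ltnP 1 #|A0|.
  have cA0 : (#|A0| < #|A|)%N.
    apply: proper_card; apply/properP; split; first exact: subsetDl.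
    by exists v; rewrite // inE vU.
  rewrite -glue_outside; apply: (IHA A0_gt1 cA0 glue_splits_vanish).
    move=> G GA aG; apply: f_acyclic (within_glue GA) _.
    by apply: contra aG; apply: glue_acyclic.
  exact: within_outside.
have A0E a : a \in A0 -> a = i.
  by move=> aA0; apply/eqP; move/card_le1_eqP: A0_le1 => /(_ _ _ aA0 iA0) ->.
have cv := cross_desc_nonroot Pv iU.
have iA : i \in A by move: iA0; rewrite in_setD => /andP[].
have iv : (i < v)%N.
  by rewrite ltn_neqAle v_max // andbT; apply: contraNneq iU => /val_inj->.
have U0 : U != set0 by apply/set0Pn; exists v.
have UA : U != A by apply: contraNneq iU => ->.
apply: (split_sum_solo PA (sf (Some 0) PA sU U0 UA)) => [|Q QA PQ].
  by rewrite (split_weight_some _ cv Pv) edge_weight_neq0 /colour iv.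
move=> /split_weight_neq0[j [a [cj Qj aNj _]]] QP.
apply: (root_top_vanish (P := Q)) => //; have [vj|vj] := eqVneq v j; last first.
  by rewrite (cut_eq_noncross PQ) ?cj ?cv in_set1 ?eqxx.
case/eqP: QP; apply: (cut_eq_same_cross PQ cv); first by rewrite cj vj.
rewrite {1}vj Qj Pv; congr Some; apply: A0E; rewrite in_setD.
have [-> _] := withinP _ _ QA _ _ Qj.
by move: aNj; rewrite -vj vU; case: (a \in U).
Qed.

End Glue.

(** Descending induction on the size of the subtree at [v], which supplies [larger_vanish]. *)
Lemma top_vanish P : within A P -> f P = 0.
Proof.
have [k] := ubnP (#|A| - #|desc P v|)%N.
elim: k P => // k IH P; rewrite ltnS => cP PA.
case Pv: (P v) => [i|]; last exact: root_top_vanish.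
have [iU|iU] := boolP (i \in desc P v).
  by apply: f_acyclic PA _; apply/negP => /acyclicP/(_ _ _ Pv); rewrite iU.
apply: (nonroot_top_vanish PA Pv iU) => Q QA Qv cPQ; apply: (IH Q) => //.
apply: leq_trans cP; apply: ltn_sub2l => //; apply: leq_trans cPQ _.
by apply: subset_leq_card; apply/subsetP => u; apply: desc_within.
Qed.

End Top.

Lemma splits_vanish_within f A : (1 < #|A|)%N -> splits_vanish f A ->
  (forall P, within A P -> ~~ acyclic P -> f P = 0) ->
  forall P, within A P -> f P = 0.
Proof.
have [k] := ubnP #|A|; elim: k A f => // k IH A f; rewrite ltnS => cA A_gt1 sf aF.
have /card_gt0P[a aA] : (0 < #|A|)%N by apply: ltnW.
case: (arg_maxnP (fun j : 'I_n => val j) aA) => v vA v_max.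
apply: (top_vanish vA v_max A_gt1 sf aF) => A' f' A'_gt1 cA'.
by apply: IH A'_gt1; apply: leq_trans cA' cA.
Qed.

End Vanishing.

(** * Bracket functionals *)

Section Brackets.

Variable n : nat.
Implicit Types (A B : {set 'I_n}) (P Q G : {ffun 'I_n -> option 'I_n}).
Implicit Types (i j u v w : 'I_n) (f : {ffun 'I_n -> option 'I_n} -> rat).

(* A node [None] juxtaposes two monomials without bracketing them. *)
Inductive bracket := Leaf of 'I_n | Node of option 'I_2 & bracket & bracket.

Fixpoint leaves b : {set 'I_n} :=
  match b with Leaf i => [set i] | Node _ l r => leaves l :|: leaves r end.

Fixpoint wf b : bool :=
  match b with
  | Leaf _ => true
  | Node _ l r => [&& wf l, wf r & disj (leaves l) (leaves r)]
  end.

Definition restr A P : {ffun 'I_n -> option 'I_n} :=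
  [ffun j => obind (fun i => if (i \in A) && (j \in A) then Some i else None) (P j)].

(** For acyclic [P] this is the coefficient of the monomial of [labels b] in [edges_psi b P], by
    [edges_psi_pairing]. *)
Fixpoint pairing b P : rat :=
  match b with
  | Leaf _ => 1
  | Node k l r => pairing l P * pairing r P
      * split_weight k (leaves l) (restr (leaves l :|: leaves r) P)
  end.

Lemma restrE A P j i : restr A P j = Some i ->
  [/\ P j = Some i, i \in A & j \in A].
Proof.
by rewrite ffunE; case: (P j) => [k|//] /=; case: ifP => // /andP[? ?] [<-].
Qed.

Lemma within_restr A P : within A (restr A P).
Proof. by apply/withinP => i j /restrE[]. Qed.

Lemma restr_within A P : within A P -> restr A P = P.
Proof.
move=> /withinP PA; apply/ffunP => j; rewrite ffunE.
by case E: (P j) => [i|//] /=; have [-> ->] := PA _ _ E.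
Qed.

Lemma restr_sub A B P : A \subset B -> restr A (restr B P) = restr A P.
Proof.
move=> /subsetP AB; apply/ffunP => j; rewrite !ffunE; case: (P j) => [i|//] /=.
case: ifP => //= iB; case: ifP => // /andP[/AB iB' /AB jB'].
by rewrite iB' jB' in iB.
Qed.

Lemma pairing_restr b P Q : restr (leaves b) P = restr (leaves b) Q ->
  pairing b P = pairing b Q.
Proof.
elim: b P Q => [//|k l IHl r IHr] P Q /= PQ; rewrite PQ; congr (_ * _ * _).
  have S := subsetUl (leaves l) (leaves r).
  by apply: IHl; rewrite -(restr_sub P S) -(restr_sub Q S) PQ.
have S := subsetUr (leaves l) (leaves r).
by apply: IHr; rewrite -(restr_sub P S) -(restr_sub Q S) PQ.
Qed.

Definition glue_at B P Q : {ffun 'I_n -> option 'I_n} :=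
  [ffun j => if j \in B then P j else Q j].

Lemma cut_glue_at A B P : within A P -> B \subset A ->
  cut B P = glue_at B (restr B P) (restr (A :\: B) P).
Proof.
move=> /withinP PA /subsetP BA; apply/ffunP => j; rewrite !ffunE inE.
case E: (P j) => [i|] /=; last by case: ifP.
have [iA jA] := PA _ _ E; rewrite !in_setD iA jA !andbT.
by case: (i \in B); case: (j \in B).
Qed.

Lemma glue_at_cross A B P Q : within B P -> within (A :\: B) Q ->
  cross B (glue_at B P Q) = set0.
Proof.
move=> /withinP PB /withinP QB; apply/setP => j; rewrite !inE ffunE.
case: ifP => jB; first by case E: (P j) => [i|//]; have [->] := PB _ _ E.
case E: (Q j) => [i|//]; have [] := QB _ _ E.
by rewrite in_setD => /andP[/negPf->].
Qed.

Lemma glue_at_restr A B P Q : within B P -> within (A :\: B) Q ->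
  restr B (glue_at B P Q) = P /\ restr (A :\: B) (glue_at B P Q) = Q.
Proof.
move=> /withinP PB /withinP QB; split; apply/ffunP => j; rewrite !ffunE.
  case: ifP => jB; last first.
    have -> : P j = None; last by case: (Q j) => [i|//] /=; rewrite andbF.
    by case E: (P j) => [i|//]; have [_] := PB _ _ E; rewrite jB.
  by case E: (P j) => [i|//] /=; have [->] := PB _ _ E.
case: ifP => jB; last first.
  by case E: (Q j) => [i|//] /=; have [-> ->] := QB _ _ E.
have -> : Q j = None.
  by case E: (Q j) => [i|//]; have [_] := QB _ _ E; rewrite in_setD jB.
by case: (P j) => [i|//] /=; rewrite !in_setD jB andbF.
Qed.

Lemma glue_at_within A B P Q : B \subset A -> within B P ->
  within (A :\: B) Q -> within A (glue_at B P Q).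
Proof.
move=> /subsetP BA /withinP PB /withinP QB; apply/withinP => i j.
rewrite ffunE; case: ifP => _; first by move=> /PB[/BA-> /BA->].
by move=> /QB[]; rewrite !in_setD => /andP[_ ->] /andP[_ ->].
Qed.

Lemma cut_glue_at_eq A B P P' P'' : B \subset A -> within A P ->
  within B P' -> within (A :\: B) P'' ->
  (cut B P == cut B (glue_at B P' P'')) =
  (restr B P == P') && (restr (A :\: B) P == P'').
Proof.
move=> BA PA PB PC; have GA := glue_at_within BA PB PC.
rewrite (cut_glue_at PA BA) (cut_glue_at GA BA).
have [-> ->] := glue_at_restr PB PC.
apply/eqP/andP => [e|[/eqP-> /eqP->]] //.
have := glue_at_restr (within_restr B P) (within_restr (A :\: B) P).
by rewrite e; have [-> ->] := glue_at_restr PB PC => -[<- <-].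
Qed.

Lemma sub_acyclic P Q : (forall i j, P j = Some i -> Q j = Some i) ->
  acyclic Q -> acyclic P.
Proof.
move=> PQ /acyclicP aQ; apply/acyclicP => i j Pj.
apply: contra (aQ _ _ (PQ _ _ Pj)).
apply: (@desc_ind _ P j (fun i => i \in desc Q j)); first exact: desc_refl.
by move=> a b _ aD /PQ; apply: desc_child.
Qed.

(** The parent functions on [A] are grouped by their restrictions to [B] and to [A :\: B], the same
    data as the cut along [B]. *)
Lemma sum_split_sum f A B k (p q : {ffun 'I_n -> option 'I_n} -> rat) :
  B \subset A ->
  \sum_(P | within B P) \sum_(Q | within (A :\: B) Q)
    p P * q Q * split_sum f A B k (glue_at B P Q) =
  \sum_(P | within A P)
    f P * (p (restr B P) * q (restr (A :\: B) P) * split_weight k B P).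
Proof.
move=> BA; rewrite pair_big /=.
rewrite (partition_big (fun P => (restr B P, restr (A :\: B) P))
  (fun PQ => within B PQ.1 && within (A :\: B) PQ.2)) /=; last first.
  by move=> P _; rewrite !within_restr.
apply: eq_bigr => -[P Q] /= /andP[PB QB]; rewrite /split_sum mulr_sumr.
apply: eq_big => [G|G /andP[GA]].
  by case GA: (within A G) => //=; rewrite (cut_glue_at_eq BA GA PB QB) xpair_eqE.
by rewrite (cut_glue_at_eq BA GA PB QB) => /andP[/eqP-> /eqP->]; rewrite mulrCA.
Qed.

(** Induction on the size of [A]. For the bracketing [Node k l r] the hypothesis says that the split
    sum, as a function of the two pieces, pairs to 0 with [l] and [r]. The induction hypothesis in
    each piece gives the split identities, and [splits_vanish_within] concludes. *)
Lemma pairing_vanish f A : A != set0 ->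
  (forall b, wf b -> leaves b = A ->
     \sum_(P | within A P) f P * pairing b P = 0) ->
  (forall P, within A P -> ~~ acyclic P -> f P = 0) ->
  forall P, within A P -> f P = 0.
Proof.
have [m] := ubnP #|A|; elim: m A f => // m IH A f; rewrite ltnS => cA A0 fA aF.
have [A_gt1|A_le1] := ltnP 1 #|A|; last first.
  have /set0Pn[a aA] := A0.
  have eA : A = [set a].
    apply/eqP; rewrite eqEsubset sub1set aA andbT; apply/subsetP => j jA.
    by rewrite inE; apply/eqP; move/card_le1_eqP: A_le1 => /(_ _ _ jA aA) ->.
  subst A => P PA; have [aP|] := boolP (acyclic P); last exact: aF.
  have nP Q : within [set a] Q -> acyclic Q -> Q = [ffun=> None].
    move=> /withinP QA /acyclicP aQ; apply/ffunP => j; rewrite ffunE.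
    case E: (Q j) => [i|//]; have [] := QA _ _ E; rewrite !inE => /eqP ia /eqP ja.
    by have := aQ _ _ E; rewrite ia ja desc_refl.
  have := fA (Leaf a) isT erefl; rewrite (bigD1 P) //= big1 => [|Q /andP[QA QP]].
    by rewrite mulr1 addr0.
  rewrite aF ?mul0r //; apply: contra QP => /(nP _ QA)->.
  by rewrite (nP _ PA aP).
apply: splits_vanish_within => // B k P PA BA B0 BnA.
have [cB cC] : (#|B| < m)%N /\ (#|A :\: B| < m)%N.
  have pBA : B \proper A by rewrite properEneq BnA.
  split; apply: leq_trans cA; apply: proper_card => //.
  apply/properP; split; first exact: subsetDl.
  have [b bB] := set0Pn _ B0; exists b; first exact: (subsetP BA).
  by rewrite inE bB.
have C0 : A :\: B != set0 by apply: contra BnA; rewrite setD_eq0 eqEsubset BA.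
have dBC : disj B (A :\: B) by rewrite /disj setIDA setIC -setIDA setDv setI0.
(* A cycle in a piece persists in everything that is cut into it, so the split sum also vanishes on
   cyclic pieces, as the induction hypothesis requires. *)
have cyc P' P'' : within B P' -> within (A :\: B) P'' ->
    ~~ acyclic P' || ~~ acyclic P'' ->
    split_sum f A B k (glue_at B P' P'') = 0.
  move=> PB PC; rewrite -negb_and => naP; apply: big1 => Q /andP[QA].
  rewrite (cut_glue_at_eq BA QA PB PC) => /andP[/eqP eB /eqP eC].
  rewrite aF ?mul0r //; apply: contra naP => aQ; rewrite -eB -eC.
  by apply/andP; split; apply: sub_acyclic aQ => i j /restrE[].
have sum0 l r : wf l -> leaves l = B -> wf r -> leaves r = A :\: B ->
    \sum_(P' | within B P') \sum_(P'' | within (A :\: B) P'')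
       pairing l P' * pairing r P'' * split_sum f A B k (glue_at B P' P'') = 0.
  move=> wl lB wr rC; rewrite sum_split_sum //.
  have lrA : leaves l :|: leaves r = A.
    by rewrite lB rC -[X in X :|: _](setIidPr BA) setID.
  have dlr : disj (leaves l) (leaves r) by rewrite lB rC.
  have := fA (Node k l r); rewrite /= wl wr dlr lrA lB.
  move=> /(_ isT erefl) E; rewrite -[RHS]E; apply: eq_bigr => Q QA.
  rewrite (restr_within QA).
  congr (_ * (_ * _ * _)); apply: pairing_restr.
    by rewrite lB restr_sub.
  by rewrite rC restr_sub.
(* Induction on [B] removes the pairing with [l]; the pairing with [r] is removed below by induction
   on [A :\: B]. *)
have {}sum0 r P' : wf r -> leaves r = A :\: B -> within B P' ->
    \sum_(P'' | within (A :\: B) P'')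
       pairing r P'' * split_sum f A B k (glue_at B P' P'') = 0.
  move=> wr rC PB; apply: (IH B (fun P' => \sum_(P'' | within (A :\: B) P'')
    pairing r P'' * split_sum f A B k (glue_at B P' P''))) PB => //.
    move=> l wl lB; rewrite -[RHS](sum0 l r) //; apply: eq_bigr => Q _.
    by rewrite mulr_suml; apply: eq_bigr => Q' _; ring.
  by move=> Q QB naQ; apply: big1 => Q' QC; rewrite cyc ?mulr0 ?naQ.
suff h P' P'' : within B P' -> within (A :\: B) P'' ->
    split_sum f A B k (glue_at B P' P'') = 0.
  rewrite -[RHS](h (restr B P) (restr (A :\: B) P)) ?within_restr //.
  apply: eq_bigl => Q; congr (_ && (_ == _)); rewrite (cut_glue_at PA BA).
  by apply/ffunP => j; rewrite [RHS]ffunE (glue_at_cross (A := A)) ?within_restr // inE.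
move=> PB PC.
apply: (IH (A :\: B) (fun Q => split_sum f A B k (glue_at B P' Q))) PC => //.
  by move=> r wr rC; rewrite -[RHS](sum0 r P') //; apply: eq_bigr => Q _; rewrite mulrC.
by move=> Q QC naQ; apply: cyc; rewrite ?naQ ?orbT.
Qed.

End Brackets.

(** * Bracket functionals as coefficients of polynomials *)

Section Realization.

Variable n : nat.
Implicit Types (A B : {set 'I_n}) (P Q G : {ffun 'I_n -> option 'I_n}).
Implicit Types (b : bracket n) (i j u v w : 'I_n) (p q : {mpoly rat[n]}).

Fixpoint head b : 'I_n :=
  match b with Leaf i => i | Node _ l _ => head l end.

(* The variable attached to a bracketing node is named after the first leaf of
   its right subtree. *)
Fixpoint labels b : {set 'I_n} :=
  match b with
  | Leaf _ => set0
  | Node k l r =>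
      labels l :|: labels r :|: (if k then [set head r] else set0)
  end.

Fixpoint psi b (c : 'I_2) i j : {mpoly rat[n]} :=
  match b with
  | Leaf _ => 0
  | Node k l r =>
      let g := (k == Some c)%:R *: 'X_(head r) in
      if i \in leaves l then
        if j \in leaves l then psi l c i j
        else if j \in leaves r then g else 0
      else if i \in leaves r then
        if j \in leaves l then - g
        else if j \in leaves r then psi r c i j else 0
      else 0
  end.

Lemma psi_anti b c i j : psi b c j i = - psi b c i j.
Proof.
elim: b => [a|k l IHl r IHr] /=; first by rewrite oppr0.
by case: (i \in leaves l); case: (j \in leaves l) => //;
  case: (i \in leaves r); case: (j \in leaves r); rewrite ?oppr0 ?opprK.
Qed.

(** This is membership in the ideal generated by the squares of the variables. *)
Definition no_multilinear p :=
  forall m : 'X_{1..n}, (forall s, m s <= 1)%N -> p@_m = 0.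

Lemma no_multilinear0 : no_multilinear 0.
Proof. by move=> m _; rewrite mcoeff0. Qed.

Lemma no_multilinearD p q :
  no_multilinear p -> no_multilinear q -> no_multilinear (p + q).
Proof. by move=> hp hq m hm; rewrite mcoeffD hp ?hq ?addr0. Qed.

Lemma no_multilinearM p q : no_multilinear q -> no_multilinear (p * q).
Proof.
move=> hq m hm; rewrite mcoeffM big1 // => k /eqP ek.
have ks s : (k.2 s <= m s)%N.
  by have := congr1 (fun u : 'X_{1..n} => u s) ek; rewrite mnmDE => ->; apply: leq_addl.
by rewrite hq ?mulr0 // => s; apply: leq_trans (ks s) (hm s).
Qed.

Lemma no_multilinearZ a p : no_multilinear p -> no_multilinear (a *: p).
Proof. by move=> hp; rewrite -mul_mpolyC; apply: no_multilinearM. Qed.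

Lemma no_multilinear_square s : no_multilinear ('X_s * 'X_s).
Proof.
move=> m hm; rewrite -mpolyXD mcoeffX; case: eqP => // e.
by have := hm s; rewrite -e mnmDE !mnm1E eqxx.
Qed.

Lemma no_multilinear_ZZ a a' s : no_multilinear ((a *: 'X_s) * (a' *: 'X_s)).
Proof.
rewrite -scalerAl -scalerAr; do 2 apply: no_multilinearZ.
exact: no_multilinear_square.
Qed.

Lemma psi_square b c d i j : no_multilinear (psi b c i j * psi b d i j).
Proof.
have N0 := no_multilinear0; have ZZ := no_multilinear_ZZ.
elim: b => [a|k l IHl r IHr] /=; first by rewrite mul0r.
by case: (i \in leaves l); case: (j \in leaves l) => //;
  case: (i \in leaves r); case: (j \in leaves r); rewrite /= ?mul0r ?mulrNN;
  first [exact: N0 | exact: ZZ | exact: IHl | exact: IHr].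
Qed.

(** If the top node separates one of the three leaves from the other two, the terms with the inner
    letter cancel and [- 2 * g * h] remains, a multiple of the square of the top variable. *)
Lemma psi_arnold b c d i j k : no_multilinear
  (psi b c i j * psi b d j k + psi b c j k * psi b d k i
   + psi b c k i * psi b d i j
   + (psi b d i j * psi b c j k + psi b d j k * psi b c k i
      + psi b d k i * psi b c i j)).
Proof.
elim: b => [a|o l IHl r IHr] /=; first by rewrite !mul0r !addr0; apply: no_multilinear0.
set g := _ *: _; set h := _ *: _.
have gh : no_multilinear (g * h) by apply: no_multilinear_ZZ.
have N0 : no_multilinear 0 by apply: no_multilinear0.
have N2 : no_multilinear (- 2%:R * (g * h)) by apply: no_multilinearM.
case: (i \in leaves l); case: (j \in leaves l); case: (k \in leaves l) => //;
  case: (i \in leaves r) => //; case: (j \in leaves r) => //;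
  case: (k \in leaves r) => //;
  first [ by [] | rewrite (_ : _ + _ = 0); [by [] | by ring]
        | rewrite (_ : _ + _ = - 2%:R * (g * h)); [by [] | by ring]].
Qed.

Lemma psi_arnold_diag b c i j k : no_multilinear
  (psi b c i j * psi b c j k + psi b c j k * psi b c k i
   + psi b c k i * psi b c i j).
Proof.
have /(no_multilinearZ (2%:R^-1)) := psi_arnold b c c i j k.
by rewrite -mulr2n -scaler_nat scalerA mulVf // scale1r.
Qed.

Definition mset A : 'X_{1..n} := [multinom (s \in A : nat) | s < n].

Lemma leaves_head b : head b \in leaves b.
Proof. by elim: b => [i|k l IHl r IHr] /=; rewrite ?inE ?eqxx ?IHl. Qed.

Lemma labels_leaves b : wf b -> labels b \subset leaves b :\ head b.
Proof.
elim: b => [i|k l IHl r IHr] /=; first by rewrite sub0set.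
case/and3P => /IHl/subsetP sl /IHr/subsetP sr dlr; apply/subsetP => s.
have hr : head r \in leaves l :|: leaves r by rewrite in_setU leaves_head orbT.
rewrite !in_setU in_setD1 in_setU => /orP[/orP[/sl|/sr]|].
- by rewrite in_setD1 => /andP[-> ->].
- rewrite in_setD1 => /andP[_ sR]; rewrite sR orbT andbT eq_sym.
  by apply: disj_neq dlr _ sR; apply: leaves_head.
case: k => [c|]; rewrite inE // => /eqP->; rewrite leaves_head orbT andbT eq_sym.
by apply: disj_neq dlr _ _; apply: leaves_head.
Qed.

Definition edges_psi b P : {mpoly rat[n]} :=
  \prod_j oapp (fun i => psi b (colour i j) i j) 1 (restr (leaves b) P j).

Lemma edges_psi_node k l r P : disj (leaves l) (leaves r) ->
  edges_psi (Node k l r) P = edges_psi l P * edges_psi r P *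
   \prod_(j in cross (leaves l) (restr (leaves l :|: leaves r) P))
     (oapp (edge_weight k (leaves l) ^~ j) 1
        (restr (leaves l :|: leaves r) P j) *: 'X_(head r)).
Proof.
move=> dlr; rewrite [X in _ * X]big_mkcond -!big_split; apply: eq_bigr => j _ /=.
have notboth i : i \in leaves r -> (i \in leaves l) = false.
  by move=> iR; apply/negbTE; apply: disj_notin dlr iR.
rewrite inE !ffunE; case: (P j) => [i|] /=; last by rewrite !mulr1.
rewrite !in_setU.
have ni := notboth i; have nj := notboth j.
case iL: (i \in leaves l) ni; case iR: (i \in leaves r) => ni;
  case jL: (j \in leaves l) nj; case jR: (j \in leaves r) => nj;
  try (by have := ni isT); try (by have := nj isT);
  rewrite /= ?iL ?iR ?jL ?jR /= ?mulr1 ?mul1r //.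
  by rewrite /edge_weight iL; case: eqP.
by rewrite /edge_weight iL; case: eqP => _; rewrite ?scaleN1r ?scale1r ?scale0r ?oppr0.
Qed.

Definition supported A (m : 'X_{1..n}) := forall s, s \notin A -> m s = 0%N.

Lemma mset_supported A B : A \subset B -> supported B (mset A).
Proof.
move=> /subsetP AB s sB; rewrite mnmE; case: (boolP (s \in A)) => // /AB.
by rewrite (negPf sB).
Qed.

(** The supports [A], [B :\ h] and [h] are disjoint, so the three exponents are read off
    separately. *)
Lemma supported_join_eq A B h (m1 m1' m2 m2' : 'X_{1..n}) k k' :
  disj A B -> h \in B -> supported A m1 -> supported A m1' ->
  supported (B :\ h) m2 -> supported (B :\ h) m2' ->
  (m1 + m2 + U_(h) *+ k == m1' + m2' + U_(h) *+ k')%MM =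
  [&& m1 == m1', m2 == m2' & k == k'].
Proof.
move=> dAB hB s1 s1' s2 s2'; apply/eqP/and3P => [/mnmP e|[/eqP-> /eqP-> /eqP->]//].
have BA s : s \in B -> s \notin A by apply: disj_notin.
have {}e s := e s; split; apply/eqP; last first.
- have := e h; rewrite !(mnmDE, mulmnE) mnm1E eqxx ?muln1 ?mul1n.
  by rewrite s1 ?BA // s1' ?BA // s2 ?s2' // !inE eqxx.
- apply/mnmP => s; have [sB|sB] := boolP (s \in B :\ h); last by rewrite s2 ?s2'.
  have := e s; rewrite !(mnmDE, mulmnE) mnm1E; move: sB; rewrite in_setD1.
  move=> /andP[sh sB]; rewrite eq_sym (negPf sh) ?muln0 ?mul0n !addn0.
  by rewrite s1 ?BA // s1' ?BA.
apply/mnmP => s; have [sA|sA] := boolP (s \in A); last by rewrite s1 ?s1'.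
have sB : s \notin B by apply: contraL sA; apply: BA.
have := e s; rewrite !(mnmDE, mulmnE) mnm1E.
have -> : (h == s) = false by apply: contraNF sB => /eqP <-.
by rewrite ?muln0 ?mul0n !addn0 s2 ?s2' ?addn0 // !inE (negPf sB) andbF.
Qed.

(** Induction on the bracketing. The crossing edges contribute the power [#|C|] of the variable of
    the node, so the required exponent means one crossing edge at a coloured node and none at an
    uncoloured one. At a leaf, acyclicity excludes a loop. *)
Lemma edges_psi_pairing b P : wf b -> acyclic P -> exists a m,
  [/\ edges_psi b P = a *: 'X_[m], supported (leaves b :\ head b) m
    & a * (m == mset (labels b))%:R = pairing b P].
Proof.
move=> + /acyclicP aP; elim: b => [i _|k l IHl r IHr].
  exists 1, 0%MM; split=> //=.
  - rewrite mpolyX0 scale1r /edges_psi big1 // => j _.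
    case E: (restr _ _ j) => [a|//]; have [/= Pj] := restrE E.
    rewrite !inE => /eqP ai /eqP ji.
    by have := aP _ _ Pj; rewrite ai ji desc_refl.
  - by move=> s _; rewrite mnm0E.
  - by rewrite mul1r; case: eqP => // -[]; apply/mnmP => s; rewrite mnm0E mnmE inE.
move=> /= /and3P[wl wr dlr].
have [al [ml [el sl pl]]] := IHl wl; have [ar [mr [er sr pr]]] := IHr wr.
have subl := labels_leaves wl; have subr := labels_leaves wr.
have hl := leaves_head l; have hr := leaves_head r.
have hlr : head l != head r by apply: disj_neq dlr _ _.
have sl' : supported (leaves l) ml.
  by move=> s sL; rewrite sl // in_setD1 negb_and sL orbT.
rewrite edges_psi_node // el er scaler_prod prodr_const mpolyXn.
set C := cross _ _; set w := \prod_(j in _) _.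
exists (al * ar * w), (ml + mr + U_(head r) *+ #|C|)%MM; split.
- by rewrite !mpolyXD -!mul_mpolyC !mpolyCM; ring.
- move=> s; rewrite in_setD1 in_setU negb_and negbK negb_or => sb.
  have [sm1 sm2 sh] : [/\ ml s = 0%N, mr s = 0%N & (head r == s) = false].
    case/orP: sb => [/eqP->|/andP[sL sR]].
      rewrite sl ?in_setD1 ?eqxx // sr ?in_setD1; last first.
        by rewrite negb_and (contraL (disj_notin dlr)) ?orbT.
      by rewrite eq_sym (negPf hlr).
    rewrite sl' // sr ?in_setD1 ?negb_and ?sR ?orbT //; split=> //.
    by apply: contraNF sR => /eqP<-.
  by rewrite !mnmDE mulmnE mnm1E sm1 sm2 sh.
have -> : mset (labels l :|: labels r :|: (if k then [set head r] else set0)) =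
    (mset (labels l) + mset (labels r) + U_(head r) *+ (k != None))%MM.
  apply/mnmP => s; rewrite !mnmDE mulmnE mnm1E !mnmE !in_setU.
  have [sl1|_] := boolP (s \in labels l).
    have := subsetP subl _ sl1; rewrite in_setD1 => /andP[_ sL].
    have sR : s \notin leaves r by apply: contraL sL; apply: disj_notin.
    have -> : s \in labels r = false.
      by apply: contraNF sR => /(subsetP subr); rewrite in_setD1 => /andP[].
    have sh : (head r == s) = false by apply: contraNF sR => /eqP<-.
    by rewrite sh !addn0.
  have [sr1|_] := boolP (s \in labels r).
    have := subsetP subr _ sr1; rewrite in_setD1 => /andP[sh _].
    by rewrite eq_sym (negPf sh) addn0.
  by case: (k) => [c|]; rewrite ?in_set1 ?in_set0 ?muln1 ?muln0 1?eq_sym.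
rewrite (supported_join_eq _ _ dlr hr) //.
- rewrite -pl -pr /split_weight -/C -/w.
  by rewrite -!mulnb !natrM; ring.
- by apply: mset_supported; apply: subset_trans subl (subD1set _ _).
- exact: mset_supported.
Qed.

End Realization.

(** * Counting rooted forests *)

Section ForestCount.

Variable R : comNzRingType.

(** Multilinearity of the determinant in its rows. *)
Lemma det_rows_sum n (I : finType) (w : I -> 'I_n -> R) (V : I -> 'I_n -> 'I_n -> R) :
  \det (\matrix_(j, i) \sum_o w o j * V o j i) =
  \sum_(p : {ffun 'I_n -> I}) (\prod_j w (p j) j) * \det (\matrix_(j, i) V (p j) j i).
Proof.
under [RHS]eq_bigr => p _ do rewrite /determinant mulr_sumr.
rewrite exchange_big; apply: eq_bigr => s _ /=.
under eq_bigr => j _ do rewrite mxE.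
rewrite bigA_distr_bigA mulr_sumr; apply: eq_bigr => p _.
rewrite big_split mulrCA; do 2 congr (_ * _).
by apply: eq_bigr => j _; rewrite mxE.
Qed.

Definition laplacian n (P : {ffun 'I_n -> option 'I_n}) : 'M[R]_n :=
  \matrix_(j, i) ((i == j)%:R - (P j == Some i)%:R).

(** Only the identity permutation contributes: a nonzero term for another [s] would make [s t] the
    parent of every moved point [t], and an orbit of [s] would be a cycle of [P]. *)
Lemma det_laplacian_acyclic n (P : {ffun 'I_n -> option 'I_n}) :
  acyclic P -> \det (laplacian P) = 1.
Proof.
move=> /acyclicP aP; have nloop j : P j == Some j = false.
  by apply/negP => /eqP/aP; rewrite desc_refl.
rewrite /determinant (bigD1 (1%g : 'S_n)) //= odd_perm1 mul1r !big1 ?addr0 //.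
  move=> s s1; have [j sj] : exists j, s j != j.
    apply/existsP; apply: contraR s1; rewrite negb_exists => /forallP h.
    by apply/eqP/permP => j; rewrite perm1; apply/eqP; have := h j; rewrite negbK.
  have moved t : s (iter t s j) != iter t s j.
    by elim: t => //= t; rewrite (inj_eq perm_inj).
  have [/forallP h|] := boolP [forall t, (P t == Some (s t)) || (s t == t)].
    have climb t : s j \in desc P (iter t s (s j)).
      elim: t => [|t IH]; first exact: desc_refl.
      have := h (iter t s (s j)); rewrite -iterSr (negPf (moved _)) orbF => /eqP Pt.
      rewrite -iterSr iterS; move: IH; rewrite -iterSr => IH.
      have D := desc_child (desc_refl P _) Pt.
      by move: D IH; rewrite !inE; apply: connect_trans.
    (* After this number of steps the climb is back at [j], so the parent [s j] of [j] is a
       descendant of [j]. *)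
    have := climb #[s]%g.-1.
    rewrite -iterSr prednK ?order_gt0 // -permX expg_order perm1.
    move=> D; have := h j; rewrite (negPf sj) orbF => /eqP/aP.
    by rewrite D.
  rewrite negb_forall => /existsP[t]; rewrite negb_or => /andP[/negPf Pt /negPf st].
  by rewrite (bigD1 t) //= mxE st Pt subrr mul0r mulr0.
by move=> j _; rewrite mxE perm1 eqxx nloop subr0.
Qed.

(** The indicator of the vertices below no root lies in the kernel, since a non-root is below a root
    exactly when its parent is. Its entry at a vertex of a cycle is 1, and the adjugate turns this
    into the vanishing of the determinant over any commutative ring. *)
Lemma det_laplacian_cyclic n (P : {ffun 'I_n -> option 'I_n}) :
  ~~ acyclic P -> \det (laplacian P) = 0.
Proof.
move=> naP; have [v [i [Pv iv]]] : exists v i, P v = Some i /\ i \in desc P v.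
  move: naP; rewrite negb_forall => /existsP[v]; case Pv: (P v) => [i|//].
  by rewrite negbK => iv; exists v, i.
pose rooted j := [exists r, (P r == None) && (j \in desc P r)].
have rootedP j : rooted j = if P j is Some k then rooted k else true.
  case Pj: (P j) => [k|]; last by apply/existsP; exists j; rewrite Pj eqxx desc_refl.
  apply/existsP/existsP => -[r /andP[/eqP Pr rD]]; exists r; rewrite Pr eqxx /=.
    have jr : j != r by apply: contra_eq_neq Pj => ->; rewrite Pr.
    exact: desc_parent_in Pj rD jr.
  exact: desc_child Pj.
have parent_in x y : y \in desc P v -> P y = Some x -> x \in desc P v.
  have [-> _|yv yD Py] := eqVneq y v; first by rewrite Pv => -[<-].
  exact: desc_parent_in Py yD yv.
have nv : ~~ rooted v.
  apply/existsP => -[r /andP[/eqP Pr vD]].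
  have rD : r \in desc P v.
    have := desc_refl P v; move: vD.
    apply: (@desc_ind _ P r (fun u => u \in desc P v -> r \in desc P v)) => //.
    by move=> x y _ IH Py /parent_in/(_ Py).
  have [rv|rv] := eqVneq r v; first by rewrite rv Pv in Pr.
  by have [k] := desc_parent rD rv; rewrite Pr.
pose u : 'cV[R]_n := \col_j (~~ rooted j)%:R.
have Lu : laplacian P *m u = 0.
  apply/matrixP => j k; rewrite !mxE.
  under eq_bigr => l _ do rewrite !mxE mulrBl.
  rewrite sumrB (bigD1 j) //= eqxx mul1r big1 ?addr0 => [|l /negPf->].
    2: by rewrite mul0r.
  rewrite rootedP; case Pj: (P j) => [l|].
    rewrite (bigD1 l) //= eqxx mul1r big1 ?addr0 ?subrr // => l' l'l.
    by rewrite (inj_eq Some_inj) eq_sym (negPf l'l) mul0r.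
  by rewrite big1 ?subr0 // => l _; rewrite mul0r.
have : (\det (laplacian P))%:M *m u = 0 by rewrite -mul_adj_mx -mulmxA Lu mulmx0.
by move/matrixP/(_ v 0); rewrite mul_scalar_mx !mxE nv mulr1.
Qed.

Variables (m : nat) (a b : R).
Local Notation n := m.+1.

Definition arrow_weight (i j : 'I_n) : R := if (i < j)%N then a else b.
Definition forest_weight (P : {ffun 'I_n -> option 'I_n}) : R :=
  \prod_j oapp (arrow_weight ^~ j) 1 (P j).

(** The weighted Laplacian, with 1 on the diagonal for the choice of a root. Labels count from 0, so
    [j] has [j] smaller and [m - j] larger labels. *)
Definition kirchhoff (j i : nat) : R :=
  if (i < j)%N then - a else if (j < i)%N then - b
  else 1 + j%:R * a + (m - j)%:R * b.

Lemma sum_arrow_weight (j : 'I_n) :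
  \sum_i arrow_weight i j = j%:R * a + (n - j)%:R * b.
Proof.
rewrite /arrow_weight (bigID (fun i : 'I_n => (i < j)%N)) /=.
rewrite (eq_bigr (fun=> a)) => [|i ->//]; rewrite sumr_const.
rewrite (eq_bigr (fun=> b)) => [|i /negPf->//]; rewrite sumr_const.
have cj : #|[pred i : 'I_n | (i < j)%N]| = j.
  have jn : (j <= n)%N by apply: ltnW.
  rewrite -sum1_card; transitivity (\sum_(i < j) 1)%N.
    by rewrite (big_ord_widen _ (fun=> 1%N) jn).
  by rewrite sum1_card card_ord.
rewrite -(mulr_natl a) -(mulr_natl b); congr (_%:R * _ + _%:R * _); first exact: cj.
have := cardC [pred i : 'I_n | (i < j)%N]; rewrite cj card_ord => e.
have -> : (n - j)%N = #|[predC [pred i : 'I_n | (i < j)%N]]|.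
  by rewrite -[X in (X - _)%N]e addKn.
by apply: eq_card => i; rewrite !inE.
Qed.

(** The matrix-tree theorem: each row is a sum over the possible parents, so the determinant is the
    sum over all parent functions of the weight times the determinant of [laplacian P], which is 1
    or 0. *)
Lemma det_kirchhoff :
  \sum_(P | acyclic P) forest_weight P = \det (\matrix_(j < n, i < n) kirchhoff j i).
Proof.
pose w (o : option 'I_n) j : R := oapp (arrow_weight ^~ j) 1 o.
pose V (o : option 'I_n) (j i : 'I_n) : R := (i == j)%:R - (o == Some i)%:R.
have := det_rows_sum w V; rewrite (bigID (@acyclic n)) /=.
rewrite [X in _ = _ + X]big1 ?addr0 => [E|P /det_laplacian_cyclic]; last first.
  by rewrite /laplacian => ->; rewrite mulr0.
transitivity (\det (\matrix_(j, i) \sum_o w o j * V o j i)).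
  rewrite E; apply: eq_bigr => P /det_laplacian_acyclic.
  by rewrite /laplacian => ->; rewrite mulr1.
congr (\det _); apply/matrixP => j i; rewrite !mxE.
under eq_bigr => o _ do rewrite mulrBr.
rewrite sumrB -mulr_suml [X in _ - X](bigD1 (Some i)) //= eqxx mulr1.
rewrite [X in _ - (_ + X)]big1 ?addr0 => [|o /negPf->]; last by rewrite mulr0.
have -> : \sum_o w o j = 1 + \sum_i arrow_weight i j.
  rewrite (bigD1 None) //=; congr (_ + _).
  rewrite (reindex_omap Some id) /=; last by case.
  by apply: eq_bigl => k; rewrite eqxx.
(* The row sum counts a loop at [j] with weight [b]; the diagonal term removes it, which turns
   [n - j] into [m - j]. *)
rewrite sum_arrow_weight /kirchhoff /arrow_weight -val_eqE /=.
case: (ltngtP i j) => ij; rewrite ?mulr0 ?sub0r ?mulr1 //.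
have jm : (j <= m)%N by rewrite -ltnS.
by rewrite subSn // -natr1; ring.
Qed.

Lemma sum_delta (F : nat -> R) j :
  \sum_(l < n) F l * (val l == j)%:R = if (j < n)%N then F j else 0.
Proof.
case: ltnP => jn; last first.
  rewrite big1 // => l _; rewrite (_ : (val l == j) = false) ?mulr0 //.
  by apply/negbTE; rewrite neq_ltn (leq_trans (ltn_ord l) jn).
rewrite (bigD1 (Ordinal jn)) //= eqxx mulr1 big1 ?addr0 // => l.
by rewrite -val_eqE /= => /negPf->; rewrite mulr0.
Qed.

Lemma forest_weight_sum :
  \sum_(P | acyclic P) forest_weight P =
  \prod_(1 <= k < n) (1 + k%:R * a + (n - k)%:R * b).
Proof.
rewrite det_kirchhoff.
(* Multiplying by [D] on the left subtracts from each row the next one. For [j < m] the difference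
   of rows [j] and [j.+1] of the Kirchhoff matrix is a multiple of row [j] of [D], and the last row
   of [t] expands row [m] in the rows of [D]. Hence the product is [T *m D] with [T] lower
   triangular. *)
pose D : 'M[R]_n := \matrix_(j, i) ((i == j :> nat)%:R - (i == j.+1 :> nat)%:R).
pose t (j i : nat) : R :=
  if (j < m)%N then (i == j)%:R * (1 + j.+1%:R * a + (m - j)%:R * b)
  else if (i < m)%N then - (i.+1%:R * a) else 1.
have detD : \det D = 1.
  rewrite -det_tr det_trig; last first.
    apply/is_trig_mxP => i j ij; rewrite !mxE ltn_eqF //.
    by rewrite ltn_eqF ?subrr // ltnW.
  by rewrite big1 // => i _; rewrite !mxE eqxx ltn_eqF // subr0.
pose T : 'M[R]_n := \matrix_(j, i) t j i.
have DK : D *m \matrix_(j, i) kirchhoff j i = T *m D.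
  apply/matrixP => j i; rewrite !mxE.
  under eq_bigr => l _ do rewrite !mxE mulrC mulrBr.
  under [RHS]eq_bigr => l _ do rewrite !mxE mulrBr.
  rewrite !sumrB !(sum_delta (fun l => kirchhoff l i)).
  have -> : \sum_(l < n) t j l * (i == l :> nat)%:R = t j i.
    under eq_bigr => l _ do rewrite eq_sym.
    by rewrite (sum_delta (t j)) ltn_ord.
  have -> : \sum_(l < n) t j l * (i == l.+1 :> nat)%:R =
      if (i : nat) is i'.+1 then t j i' else 0.
    case: i => [[|i'] /= im]; first by rewrite big1 // => l _; rewrite mulr0.
    under eq_bigr => l _ do rewrite eqSS eq_sym.
    by rewrite (sum_delta (t j)) ltnW.
  rewrite ltn_ord ltnS; case: j i => [j jn] [i im] /=; rewrite !ltnS in jn im.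
  rewrite /t /kirchhoff; have [jm|mj] := ltnP j m.
    have -> : (match i with 0%N => 0 | i'.+1 => (i' == j)%:R *
        (1 + j.+1%:R * a + (m - j)%:R * b) end) =
        (i == j.+1)%:R * (1 + j.+1%:R * a + (m - j)%:R * b).
      by case: (i) => [|i']; rewrite ?eqSS // mul0r.
    rewrite -[X in X%:R * b](subnSK jm) -!natr1 ltnS.
    case: (ltngtP i j) => [ij|ji|->].
    - by rewrite ltn_eqF ?ltnS 1?ltnW //; ring.
    - case: (ltngtP j.+1 i) => [_|ij|_]; rewrite /=; try ring.
      by rewrite ltnNge ji in ij.
    - by rewrite ltn_eqF //=; ring.
  have -> : j = m by apply/eqP; rewrite eqn_leq jn mj.
  rewrite subr0; have [im'|mi] := ltnP i m.
    by case: i im' {im} => [|i] im; rewrite ?(ltnW im) -?natr1; ring.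
  have -> : i = m by apply/eqP; rewrite eqn_leq im mi.
  by rewrite ltnn subnn; case: (m) => [|k]; rewrite ?ltnSn -?natr1; ring.
have : \det D * \det (\matrix_(j < n, i < n) kirchhoff j i) = \det T * \det D.
  by rewrite -!det_mulmx DK.
rewrite detD mul1r mulr1 => ->; rewrite det_trig; last first.
  apply/is_trig_mxP => j i ji; rewrite mxE /t; case: ltnP => jm.
    by rewrite gtn_eqF // mul0r.
  by have := leq_ltn_trans jm ji; rewrite ltnNge -ltnS ltn_ord.
rewrite big_ord_recr /= mxE /t ltnn mulr1 big_add1 /= big_mkord.
by apply: eq_bigr => j _; rewrite mxE /t /= ltn_ord eqxx mul1r subSS.
Qed.

End ForestCount.

(** * The Orlik-Solomon algebra *)

Section Assembly.

Variable n : nat.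
Implicit Types (P Q : {ffun 'I_n -> option 'I_n}) (c d : 'I_2) (i j k : 'I_n).

Local Notation L c i j := (os_pi (os_letter c i j)).

Lemma I2_01 c : c = 0 \/ c = 1.
Proof. exact: I2_cases. Qed.

Lemma os_rel0 (p : os_poly n) : os_rel p -> os_pi p = 0.
Proof. by move=> rp; apply/eqP; rewrite os_pi_eq0; apply: os_rel_ideal. Qed.

Lemma os_letter_diag c i : os_letter c i i = 0.
Proof. by rewrite /os_letter insubF //= eqxx. Qed.

Lemma os_anti c i j : L c j i = - L c i j.
Proof.
have [->|ij] := eqVneq i j; first by rewrite os_letter_diag rmorph0 oppr0.
apply/eqP; rewrite -addr_eq0 addrC -rmorphD; apply/eqP/os_rel0.
by have [->|->] := I2_01 c; [apply: os_antisym_x | apply: os_antisym_y].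
Qed.

Lemma os_square c d i j : L c i j * L d i j = 0.
Proof.
have [->|ij] := eqVneq i j; first by rewrite os_letter_diag rmorph0 mul0r.
rewrite -rmorphM; have [->|->] := I2_01 c; have [->|->] := I2_01 d.
- by rewrite -expr2; apply/os_rel0/os_square_xx.
- by apply/os_rel0/os_square_xy.
- by rewrite mulrC; apply/os_rel0/os_square_xy.
- by rewrite -expr2; apply/os_rel0/os_square_yy.
Qed.

Lemma os_arnold c d i j k : i != j -> j != k -> k != i ->
  L c i j * L d j k + L c j k * L d k i + L c k i * L d i j
  + (L d i j * L c j k + L d j k * L c k i + L d k i * L c i j) = 0.
Proof.
move=> ij jk ki; have xx := os_rel0 (os_arnold_xx ij jk ki).
have xy := os_rel0 (os_arnold_xy ij jk ki).
have yy := os_rel0 (os_arnold_yy ij jk ki).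
move: xx xy yy; rewrite !(rmorphD, rmorphM) /= => xx xy yy.
have [->|->] := I2_01 c; have [->|->] := I2_01 d.
- by rewrite xx addr0.
- by rewrite !addrA.
- by rewrite addrC !addrA.
- by rewrite yy addr0.
Qed.

Local Notation mono := (pmono (fun c i j => os_pi (os_letter c i j))).

(** The polynomials whose multiplication preserves the span form a subalgebra that contains the
    letters; applied to the monomial 1 of the empty forest, they give everything. *)
Lemma os_span (u : os n) : linspan (forest (fun c i j => L c i j) setT) u.
Proof.
pose S (q : os_poly n) := forall w,
  linspan (forest (fun c i j => L c i j) setT) w ->
  linspan (forest (fun c i j => L c i j) setT) (os_pi q * w).
have S1 : S 1 by move=> w; rewrite rmorph1 mul1r.
have SM q q' : S q -> S q' -> S (q * q').
  by move=> Sq Sq' w Sw; rewrite rmorphM -mulrA; apply/Sq/Sq'.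
have SX (k : 'I_#|{: os_gen n}|) : S 'X_k.
  move=> w Sw; rewrite -[k]enum_valK; case: (enum_val k) => c e.
  have := forest_letter os_anti os_square os_arnold c (val e).1 (val e).2 Sw.
  by rewrite /os_letter -surjective_pairing valK.
have [p ->] := os_piP u; rewrite -[os_pi p]mulr1.
have S1' : linspan (forest (fun c i j => L c i j) setT) (1 : os n).
  by apply/linspan_gen/forest1.
suff : S p by apply.
elim/mpolyind: p => [|a m p _ _ IH] w Sw.
  by rewrite rmorph0 mul0r; apply: linspan0.
rewrite rmorphD mulrDl; apply: linspanD; last exact: IH.
rewrite /= linearZ /= -scalerAl; apply: linspanZ; rewrite mpolyXE_id.
suff : S (\prod_(i < #|{: os_gen n}|) 'X_i ^+ m i) by apply.
apply: big_ind => // i _; elim: (m i) => // r; rewrite exprS; exact: SM.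
Qed.

Lemma os_span_forests (u : os n) : exists f : {ffun {ffun 'I_n -> option 'I_n} -> rat},
  u = \sum_(P | acyclic P) f P *: mono P.
Proof.
elim: (os_span u) => [|w fw|w w' _ [f ->] _ [f' ->]|a w _ [f ->]].
- by exists [ffun=> 0]; rewrite big1 // => P _; rewrite ffunE scale0r.
- have [P [rk [rP ->]]] := forest_ranked fw.
  have aP : acyclic P by apply: (ranked_acyclic (rk := rk)) => i j /rP[].
  exists [ffun Q => (Q == P)%:R]; rewrite (bigD1 P) //= ffunE eqxx scale1r.
  rewrite big1 ?addr0 // => Q /andP[_ /negPf QP].
  by rewrite ffunE QP scale0r.
- exists [ffun P => f P + f' P]; rewrite -big_split; apply: eq_bigr => P _.
  by rewrite ffunE scalerDl.
- exists [ffun P => a * f P]; rewrite scaler_sumr; apply: eq_bigr => P _.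
  by rewrite ffunE scalerA.
Qed.

(** * Linear independence of the forest monomials *)

Section Independence.

Variable b : bracket n.

Definition os_psi (p : os_poly n) : {mpoly rat[n]} :=
  p \mPo [tuple psi b (enum_val k).1 (val (enum_val k).2).1 (val (enum_val k).2).2
         | k < #|{: os_gen n}|].

HB.instance Definition _ := GRing.LRMorphism.copy os_psi
  (fun p => p \mPo [tuple psi b (enum_val k).1 (val (enum_val k).2).1
     (val (enum_val k).2).2 | k < #|{: os_gen n}|]).

Lemma os_psi_letter c i j : i != j -> os_psi (os_letter c i j) = psi b c i j.
Proof.
move=> ij; rewrite /os_letter insubT /os_psi /os_var comp_mpolyXU -tnth_nth.
by rewrite tnth_mktuple enum_rankK.
Qed.

Lemma os_psi_rel p : os_rel p -> no_multilinear (os_psi p).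
Proof.
case=> {p} [i j ij|i j ij|i j k ij jk ki|i j k ij jk ki|i j k ij jk ki
  |i j ij|i j ij|i j ij]; rewrite ?expr2 !(rmorphD, rmorphM) /=
  !os_psi_letter // 1?eq_sym //.
- by rewrite [psi _ _ j i]psi_anti subrr; apply: no_multilinear0.
- by rewrite [psi _ _ j i]psi_anti subrr; apply: no_multilinear0.
- exact: psi_arnold_diag.
- by have := psi_arnold b 0 1 i j k; rewrite !addrA.
- exact: psi_arnold_diag.
- exact: psi_square.
- exact: psi_square.
- exact: psi_square.
Qed.

Lemma os_psi_ideal p : p \in @os_ideal n -> no_multilinear (os_psi p).
Proof.
move=> /os_idealP[s [hs ->]]; rewrite rmorph_sum /= big_seq.
apply: big_ind => [|q q'|ar /hs/os_psi_rel h].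
- exact: no_multilinear0.
- exact: no_multilinearD.
- by rewrite rmorphM; apply: no_multilinearM.
Qed.

Lemma os_psi_mono P : leaves b = setT -> acyclic P ->
  os_psi (\prod_j oapp (fun i => os_letter (colour i j) i j) 1 (P j)) =
  edges_psi b P.
Proof.
move=> bT /acyclicP aP; rewrite rmorph_prod /edges_psi bT; apply: eq_bigr => j _.
rewrite restr_within; last by apply/withinP => i k; rewrite !inE.
case Pj: (P j) => [i|] /=; last by rewrite rmorph1.
rewrite os_psi_letter //; apply: contraTneq isT => ij.
by have := aP _ _ Pj; rewrite ij desc_refl.
Qed.

End Independence.

(** A dependence lifts to an element of the ideal. Its image under [os_psi b] has coefficient 0 at
    [mset (labels b)], which is the pairing with [b]; [pairing_vanish] applies to [f] extended by 0
    to cyclic parent functions. *)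
Lemma os_forests_free (f : {ffun 'I_n -> option 'I_n} -> rat) : (0 < n)%N ->
  \sum_(P | acyclic P) f P *: mono P = 0 -> forall P, acyclic P -> f P = 0.
Proof.
move=> n_gt0 f0 P aP; pose g Q := if acyclic Q then f Q else 0.
have wT Q : within [set: 'I_n] Q = true by apply/withinP => i j; rewrite !inE.
suff : g P = 0 by rewrite /g aP.
apply: (@pairing_vanish n g setT) => // [|b wb bT|Q _ /negPf]; last by rewrite /g => ->.
  by apply/set0Pn; exists (Ordinal n_gt0); rewrite inE.
pose z (Q : {ffun 'I_n -> option 'I_n}) : os_poly n :=
  \prod_j oapp (fun i => os_letter (colour i j) i j) 1 (Q j).
have zE Q : mono Q = os_pi (z Q).
  rewrite rmorph_prod; apply: eq_bigr => j _.
  by case: (Q j) => [i|] //=; rewrite rmorph1.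
have : \sum_(Q | acyclic Q) f Q *: z Q \in @os_ideal n.
  rewrite -os_pi_eq0 linear_sum -[X in _ == X]f0; apply/eqP/eq_bigr => Q _.
  by rewrite zE linearZ.
move=> /(os_psi_ideal b)/(_ (mset (labels b))) E.
rewrite -[RHS]E => [|s]; last by rewrite mnmE leq_b1.
rewrite [os_psi b _]linear_sum /= [RHS]raddf_sum /= [RHS]big_mkcond /= (eq_bigl _ _ wT).
apply: eq_bigr => Q _; rewrite /g; case: ifP => aQ; last by rewrite mul0r.
rewrite linearZ /= mcoeffZ os_psi_mono //.
have [a [m [-> _ <-]]] := edges_psi_pairing wb aQ.
by rewrite mcoeffZ mcoeffX.
Qed.

End Assembly.

(** * The trace of the torus on the forest basis *)

Section Character.

Variable m : nat.
Local Notation n := m.+1.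
Local Notation mono := (pmono (fun c (i j : 'I_n) => os_pi (os_letter c i j))).

(** The torus multiplies x by [q] and y by [q^-1], so every ascending arrow contributes [q] and
    every descending one [q^-1]. *)
Lemma os_act_mono (q : rat) (q0 : q != 0) (P : {ffun 'I_n -> option 'I_n}) :
  os_act (torus q0) (mono P) = forest_weight q q^-1 P *: mono P.
Proof.
rewrite /pmono rmorph_prod /forest_weight -scaler_prod /=.
apply: eq_bigr => j _; case: (P j) => [i|] /=; last by rewrite rmorph1 scale1r.
rewrite /arrow os_act_letter /arrow_weight /colour; set c : 'I_2 := if _ then _ else _.
rewrite (bigD1 c) //= big1 ?addr0 => [|d /negPf dc].
  by rewrite /c; case: ifP => _; rewrite !mxE.
by rewrite !mxE dc mulr0n scale0r.
Qed.

Definition forests := [set P : {ffun 'I_n -> option 'I_n} | acyclic P].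

Lemma sum_forests (V : nmodType) (F : {ffun 'I_n -> option 'I_n} -> V) :
  \sum_(i < #|forests|) F (enum_val i) = \sum_(P | acyclic P) F P.
Proof. by rewrite -big_enum_val; apply: eq_bigl => P; rewrite inE. Qed.

Lemma forests_basis : is_basis (fun i : 'I_#|forests| => mono (enum_val i)).
Proof.
have rowE (c : 'rV[rat]_#|forests|) : exists g : {ffun 'I_n -> option 'I_n} -> rat,
    forall i, c 0 i = g (enum_val i).
  exists (fun P => \sum_(i < #|forests| | enum_val i == P) c 0 i) => i.
  by rewrite (big_pred1 i) // => j; rewrite (inj_eq enum_val_inj).
have comb (c : 'rV[rat]_#|forests|) g : (forall i, c 0 i = g (enum_val i)) ->
    \sum_i c 0 i *: mono (enum_val i) = \sum_(P | acyclic P) g P *: mono P.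
  move=> cg; rewrite -(sum_forests (fun P => g P *: mono P)).
  by apply: eq_bigr => i _; rewrite cg.
move=> u; have [f ->] := os_span_forests u.
exists (\row_i f (enum_val i)); split=> [|c].
  by apply/esym/comb => i; rewrite mxE.
have [g cg] := rowE c; rewrite (comb _ _ cg) => /eqP; rewrite -subr_eq0 -sumrB.
under eq_bigr => P _ do rewrite -scalerBl.
move=> /eqP/(os_forests_free (ltn0Sn m)) fg; apply/rowP => i; rewrite mxE cg.
by apply/subr0_eq/fg; have := enum_valP i; rewrite inE.
Qed.

Lemma trace_torus (q : rat) (q0 : q != 0) : has_trace (@os_act n (torus q0))
  (\prod_(1 <= k < n) (1 + k%:R * q + (n - k)%:R * q^-1)).
Proof.
exists #|forests|, (fun i => mono (enum_val i)).
exists (diag_mx (\row_i forest_weight q q^-1 (enum_val i))); split.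
- exact: forests_basis.
- move=> j; rewrite os_act_mono (bigD1 j) //= big1 ?addr0 => [|i ij].
    by rewrite !mxE eqxx mulr1n.
  by rewrite !mxE (negPf ij) mulr0n scale0r.
rewrite mxtrace_diag -forest_weight_sum -sum_forests.
by apply: eq_bigr => i _; rewrite mxE.
Qed.

(** Each of the [m] factors is multiplied by [q]. The field is general because the identity serves
    both for the indeterminate [laurent_q] and for its rational values. *)
Lemma clear_denominators (F : fieldType) (q : F) : q != 0 ->
  \prod_(1 <= k < n) (1 + k%:R * q + (n - k)%:R * q^-1) =
  (\prod_(1 <= k < n) (q + k%:R * q ^+ 2 + (n - k)%:R)) / q ^+ m.
Proof.
move=> q0; rewrite !big_add1 /= !big_mkord.
have -> : q ^+ m = \prod_(i < m) q by rewrite prodr_const card_ord.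
rewrite -prodf_div.
by apply: eq_bigr => k _; field.
Qed.

End Character.

Theorem corollary3 (n : nat) (n_ge1 : (1 <= n)%N) :
  is_sl2_character (@os_act n)
    (\prod_(1 <= k < n)
       (1 + k%:R * laurent_q + (n - k)%N%:R * laurent_q^-1)).
Proof.
case: n n_ge1 => // m _.
exists (\prod_(1 <= k < m.+1) ('X + k%:R * 'X ^+ 2 + (m.+1 - k)%:R)), m; split.
  rewrite clear_denominators ?tofrac_eq0 ?polyX_eq0 //; congr (_ / _).
  rewrite rmorph_prod; apply: eq_bigr => k _.
  by rewrite !(rmorphD, rmorphM, rmorph_nat, rmorphXn).
move=> q q0; rewrite horner_prod.
have -> : \prod_(1 <= k < m.+1) ('X + k%:R * 'X ^+ 2 + (m.+1 - k)%:R).[q] / q ^+ m =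
    \prod_(1 <= k < m.+1) (1 + k%:R * q + (m.+1 - k)%:R * q^-1) :> rat.
  rewrite clear_denominators //; congr (_ / _); apply: eq_bigr => k _.
  by rewrite !hornerE -!polyC_natr ?hornerC.
exact: trace_torus.
Qed.
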